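(* Let $$D_{\mathrm{opt}}(R_{\mathrm{tot}})=\min_{0\prec K\preceq\Sigma_X}\left\{\mathrm{tr}(\tilde WK):\ \frac12\log\frac{\det\Sigma_X}{\det K}\le R_{\mathrm{tot}}\right\}.$$ (a) If $R_\ell=R_0$ for all $\ell=0,\dots,L-1$, so that $R_{\mathrm{tot}}=\sum_{\ell=0}^{L-1}R_\ell=LR_0$, then in the interior regime (that is, $\tilde W\succ0$ and the optimizer satisfies $K^\star\prec\Sigma_X$) the value $D_{\mathrm{opt}}(L):=D_{\mathrm{opt}}(LR_0)$ is $$D_{\mathrm{opt}}(L)=k(\det\Sigma_X\det\tilde W)^{1/k}\exp\!\left(-2L\frac{R_0}{k}\right).$$ (b) If an inference procedure produces intermediate states $M_1,\dots,M_T$ satisfying the incremental budget $I(X;M_t\mid M_{1:t-1})\le R_{\mathrm{step}}$ for $t=1,\dots,T$, then with total budget $R_{\mathrm{tot}}=TR_{\mathrm{step}}$ the same exponential law holds with $L$ replaced by $T$: in the interior regime, the optimal value $D_{\mathrm{opt}}(R_{\mathrm{tot}})$ governing the procedure (the lower bound on $\mathrm{tr}(\tilde W\Sigma_{X\mid M_{1:T}})$) equals $$k(\det\Sigma_X\det\tilde W)^{1/k}\exp\!\left(-2T\frac{R_{\mathrm{step}}}{k}\right).$$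
   Context: $k\ge1$; $X\sim\mathcal N(0,\Sigma_X)$ in $\mathbb R^k$, $\Sigma_X\succ0$; $B\in\mathbb R^{k\times k}$; $W_e\succ0$ symmetric $k\times k$; $\tilde W=W_e(B-I)+(B-I)^\top W_e+W_e$. $R_\ell$ is the information budget (in nats) of step $\ell$ of an $L$-step representation learner, i.e. a bound $I(X;H^{(\ell+1)}\mid H^{(\ell)})\le R_\ell$ on its internal states. $M_{1:t}=(M_1,\dots,M_t)$. $\Sigma_{X\mid U}=\mathbb E[(X-\mathbb E[X\mid U])(X-\mathbb E[X\mid U])^\top]$. Logarithms are natural; $\preceq$ is the Loewner order. *)

(* Defs.v *)
From HB Require Import structures.
From mathcomp Require Import all_boot all_order all_algebra.
From mathcomp Require Import all_classical all_reals all_analysis.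

Set Implicit Arguments.
Unset Strict Implicit.
Unset Printing Implicit Defensive.

Import Order.TTheory GRing.Theory Num.Theory.

Local Open Scope classical_set_scope.
Local Open Scope ring_scope.

Section matrices.
Context {R : realType} {k : nat}.
Implicit Types A B K S W : 'M[R]_k.

Definition psd A := A^T = A /\ forall u : 'cV[R]_k, 0 <= (u^T *m A *m u) 0 0.

Definition posdef A :=
  A^T = A /\ forall u : 'cV[R]_k, u != 0 -> 0 < (u^T *m A *m u) 0 0.

Definition loewner_le A B := psd (B - A).

Definition loewner_lt A B := posdef (B - A).

Definition tildeW (We B : 'M[R]_k) : 'M[R]_k :=
  We *m (B - 1%:M) + (B - 1%:M)^T *m We + We.

Definition feasible S (Rtot : R) : set 'M[R]_k :=
  [set K | [/\ posdef K, loewner_le K S &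
               2^-1 * ln (\det S / \det K) <= Rtot]].

(* The minimum of the problem, as an infimum; [optimizer] is attainment. *)
Definition Dopt S W (Rtot : R) : R :=
  inf [set \tr (W *m K) | K in feasible S Rtot].

Definition optimizer S W (Rtot : R) K :=
  feasible S Rtot K /\
  forall K', feasible S Rtot K' -> \tr (W *m K) <= \tr (W *m K').

Definition interior_regime S W (Rtot : R) :=
  posdef W /\ exists Kstar, optimizer S W Rtot Kstar /\ loewner_lt Kstar S.

End matrices.

Section product_space.
Context {I : Type} {d : measure_display} (S : I -> measurableType d).

Definition cylinders : set (set (forall i, S i)) :=
  [set A | exists i (B : set (S i)), measurable B /\ A = [set f | B (f i)]].

(* [forall i, S i] with the product sigma-algebra. *)
Definition prod_space := g_sigma_algebraType cylinders.

HB.instance Definition _ := Measurable.on prod_space.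

End product_space.

Section joint_variables.
Context {d : measure_display} {Omega : measurableType d}.

Definition joint {I : Type} {d' : measure_display} {S : I -> measurableType d'}
  (M : forall i, {mfun Omega >-> S i}) : Omega -> prod_space S :=
  fun w i => M i w.

Lemma measurable_joint {I : Type} {d' : measure_display}
  {S : I -> measurableType d'} (M : forall i, {mfun Omega >-> S i}) :
  measurable_fun setT (joint M).
Proof.
apply: measurability => //.
move=> _ [_ [i [B [mB ->]]] <-]; rewrite setTI.
exact: (measurable_funPTI (M i)).
Qed.

HB.instance Definition _ {I : Type} {d' : measure_display}
  {S : I -> measurableType d'} (M : forall i, {mfun Omega >-> S i}) :=
  isMeasurableFun.Build _ _ _ _ (joint M) (measurable_joint M).

Definition pairRV {d1 d2 : measure_display} {S1 : measurableType d1}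
  {S2 : measurableType d2} (X : {mfun Omega >-> S1}) (Y : {mfun Omega >-> S2}) :
  Omega -> S1 * S2 := fun w => (X w, Y w).

Lemma measurable_pairRV {d1 d2 : measure_display} {S1 : measurableType d1}
  {S2 : measurableType d2} (X : {mfun Omega >-> S1}) (Y : {mfun Omega >-> S2}) :
  measurable_fun setT (pairRV X Y).
Proof. exact: measurable_fun_pair. Qed.

HB.instance Definition _ {d1 d2 : measure_display} {S1 : measurableType d1}
  {S2 : measurableType d2} (X : {mfun Omega >-> S1}) (Y : {mfun Omega >-> S2}) :=
  isMeasurableFun.Build _ _ _ _ (pairRV X Y) (measurable_pairRV X Y).

End joint_variables.

(* Kullback-Leibler divergence, in nats. *)
Definition kl {d : measure_display} {S : measurableType d} {R : realType}
  (mu nu : probability S R) : \bar R :=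
  if `[< mu `<< nu >] then
    (\int[mu]_x lne (Radon_Nikodym (charge_of_finite_measure mu) nu x))%E
  else +oo%E.

Section conditioning.
Context {d : measure_display} {Omega : measurableType d} {R : realType}
  (P : probability Omega R).

Definition is_condexp {dU : measure_display} {SU : measurableType dU}
  (U : {RV P >-> SU}) (f : Omega -> R) : set (SU -> R) :=
  [set g | [/\ measurable_fun setT g,
    P.-integrable setT (EFin \o g \o U) &
    forall C, measurable C ->
      (\int[P]_(w in U @^-1` C) (g (U w))%:E =
       \int[P]_(w in U @^-1` C) (f w)%:E)%E]].

(* A version of u |-> E[f | U = u]; such a version exists when f is integrable. *)
Definition condexp {dU : measure_display} {SU : measurableType dU}
  (U : {RV P >-> SU}) (f : Omega -> R) : SU -> R :=
  xget (cst 0) (is_condexp U f).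

Definition condcov {k : nat} {dU : measure_display} {SU : measurableType dU}
  (X : 'I_k -> {RV P >-> R}) (U : {RV P >-> SU}) : 'M[R]_k :=
  \matrix_(i, j) fine 'E_P[fun w =>
    (X i w - condexp U (X i) (U w)) * (X j w - condexp U (X j) (U w))].

Context {d1 d2 d3 : measure_display} {S1 : measurableType d1}
  {S2 : measurableType d2} {S3 : measurableType d3}.
Variables (X : {RV P >-> S1}) (Y : {RV P >-> S2}) (Z : {RV P >-> S3}).

(* Q is P_{X|Z} P_{Y|Z} P_Z, the law making X and Y conditionally independent
   given Z. *)
Definition cond_indep_law (Q : probability (S1 * (S2 * S3))%type R) :=
  forall A B C, measurable A -> measurable B -> measurable C ->
    Q (A `*` (B `*` C)) =
    (\int[P]_(w in Z @^-1` C)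
       (condexp Z \1_(X @^-1` A) (Z w) * condexp Z \1_(Y @^-1` B) (Z w))%:E)%E.

(* I(X; Y | Z) = KL(P_{XYZ} || P_{X|Z} P_{Y|Z} P_Z).  The reference law is unique
   when it exists (rectangles generate the product sigma-algebra and are stable
   under intersection), and it exists as soon as S1 is standard Borel; so the
   infimum ranges over a singleton and only names its element. *)
Definition cond_mutual_info : \bar R :=
  ereal_inf [set kl (distribution P (pairRV X (pairRV Y Z))) Q
            | Q in cond_indep_law].

End conditioning.

Section gaussian.
Context {d : measure_display} {Omega : measurableType d} {R : realType}
  (P : probability Omega R) {k : nat}.

Definition iid_std_normal (Z : 'I_k -> {RV P >-> R}) :=
  forall B : 'I_k -> set R, (forall i, measurable (B i)) ->
    P (\bigcap_(i in setT) (Z i @^-1` B i)) =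
    (\prod_(i < k) normal_prob (0 : R) 1 (B i))%E.

(* X ~ N(0, S), as X = A Z with A A^T = S and Z standard normal.  For invertible
   S asking for Z on Omega itself is no restriction: Z = A^-1 X. *)
Definition gaussian_vector (X : 'I_k -> {RV P >-> R}) (S : 'M[R]_k) :=
  exists (A : 'M[R]_k) (Z : 'I_k -> {RV P >-> R}),
    [/\ A *m A^T = S, iid_std_normal Z &
        forall i w, X i w = \sum_(j < k) A i j * Z j w].

End gaussian.

(* Main.v *)
(* Put c = (det SigmaX det W)^(1/k) exp(-2 Rtot / k).
   Value of the problem: tr(W K) >= k (det W det K)^(1/k) by AM-GM on a Cholesky
   factor, so k c is a lower bound; since K* lies strictly below SigmaX, moving
   from K* a little towards c W^-1, where the bound is attained, stays feasible
   (superlevel sets of det are convex), so optimality of K* gives equality.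
   Bound on the procedure: by the chain rule the joint law of X and U = M_{1:T}
   has a density rho with respect to the product of its marginals and
   E ln rho <= Rtot.  Donsker-Varadhan is applied to the log-likelihood ratio
   f(x,u) = ln (N(g(u), c W^-1)(x) / N(0, SigmaX)(x)), with g(u) = E[X | U = u]:
   under the product law E exp f = 1 whatever g is, and under the joint law
   E f = (k - tr(W Sigma_{X|U}) / c) / 2 + Rtot, so that tr(W Sigma_{X|U}) >= k c. *)

Require Import Defs.
From HB Require Import structures.
From mathcomp Require Import all_boot all_order all_algebra.
From mathcomp Require Import all_classical all_reals all_analysis.
From mathcomp Require Import measurable_realfun.
From mathcomp Require Import ring lra zify.

Set Implicit Arguments.
Unset Strict Implicit.
Unset Printing Implicit Defensive.

Import Order.TTheory GRing.Theory Num.Theory.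

Local Open Scope classical_set_scope.
Local Open Scope ring_scope.

(** * Positive definite matrices *)

Section posdef_theory.
Context {R : realType}.

(** The test function compares X with its conditional mean only, so neither a regular conditional
    law of X given U nor a Gaussian density on R^k is constructed. The whitening X = A Z and a
    triangular square root C of A^T (W / c) A turn f into a sum of squares of affine functions of Z,
    and its exponential is integrated as a chain of scalar Gaussian integrals, insensitive to the
    shift by g(u). The scale c is the one with ln det C = Rtot: the information budget cancels and
    there remains k / 2 <= tr(W Sigma_{X|U}) / (2 c), for which E Z_i^2 >= 1 suffices. Two obstacles
    shape the rest. The conditional mutual information is an infimum, so each step yields a density
    only with budget Rstep + e; the total slack T e disappears by continuity in the budget. And the
    conditional mean is known only through its integrals over events of U, so its
    square-integrability, required to expand E f, is derived by cutting along its values. *)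

Lemma posdef_congr k (K C : 'M[R]_k) :
  posdef K -> C \in unitmx -> posdef (C^T *m K *m C).
Proof.
move=> [Ksym Kpos] uC; split; first by rewrite !trmx_mul trmxK Ksym mulmxA.
move=> u u0; have -> : u^T *m (C^T *m K *m C) *m u = (C *m u)^T *m K *m (C *m u).
  by rewrite trmx_mul !mulmxA.
apply: Kpos; apply: contra_neq u0 => Cu0.
by rewrite -(mulKmx uC u) Cu0 mulmx0.
Qed.

Lemma posdef_scale k (K : 'M[R]_k) (c : R) : 0 < c -> posdef K -> posdef (c *: K).
Proof.
move=> c0 [Ksym Kpos]; split; first by rewrite linearZ /= Ksym.
by move=> u u0; rewrite -scalemxAr -scalemxAl mxE mulr_gt0 ?Kpos.
Qed.

Lemma posdef_add k (K L : 'M[R]_k) : posdef K -> psd L -> posdef (K + L).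
Proof.
move=> [Ks Kp] [Ls Lp]; split; first by rewrite linearD /= Ks Ls.
by move=> u u0; rewrite mulmxDr mulmxDl mxE ltr_pwDl ?Kp.
Qed.

Lemma posdef_psd k (K : 'M[R]_k) : posdef K -> psd K.
Proof.
move=> [Ks Kp]; split => // u; have [->|/Kp/ltW//] := eqVneq u 0.
by rewrite mulmx0 mxE.
Qed.

(** Induction on the Schur complement: with the first row and column of [S] split off, the factor is
    [[s, r / s], [0, C]], where s^2 = a and [C] is a factor of D - r^T r / a. The triangular shape
    serves twice: determinants are read off the diagonal, and Gaussian integrals are done one
    coordinate at a time. *)
Lemma posdef_cholesky k (S : 'M[R]_k) : posdef S ->
  exists C : 'M[R]_k, [/\ S = C^T *m C,
    forall i j : 'I_k, (j < i)%N -> C i j = 0 & forall i, 0 < C i i].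
Proof.
elim: k S => [|k IH] S.
  by move=> _; exists 0; split => [|[]//|[]//]; apply/matrixP => -[].
rewrite -[k.+1]/(1 + k)%N in S *; move=> [Ssym Spos].
pose a := S 0 0; pose r := ursubmx S; pose D := drsubmx S.
have ulS : ulsubmx S = a%:M.
  apply/matrixP => i j; rewrite !ord1 !mxE eqxx mulr1n /a.
  by congr (S _ _); apply/val_inj.
have dlS : dlsubmx S = r^T by rewrite /r -[in RHS]Ssym trmx_ursub trmxK.
have DS : D^T = D by rewrite /D -[in RHS]Ssym trmx_drsub.
have SE : S = block_mx a%:M r r^T D by rewrite -ulS -dlS submxK.
have quad (x : 'cV[R]_1) (y : 'cV[R]_k) :
  (col_mx x y)^T *m S *m col_mx x y =
  x^T *m (a *: x + r *m y) + y^T *m (r^T *m x + D *m y).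
  by rewrite SE -mulmxA mul_block_col tr_col_mx mul_row_col mul_scalar_mx.
have a0 : 0 < a.
  have := Spos (col_mx 1%:M 0); rewrite quad !mulmx0 trmx0 mul0mx !addr0 trmx1.
  rewrite mul1mx !mxE eqxx mulr1; apply.
  apply/eqP => /(congr1 usubmx); rewrite col_mxKu linear0 => /matrixP/(_ 0 0).
  by rewrite !mxE /=; apply/eqP; rewrite oner_eq0.
have a1 : a != 0 by rewrite gt_eqF.
have [|C [TE Ctri Cpos]] := IH (D - a^-1 *: (r^T *m r)).
  split; first by rewrite linearB /= linearZ /= trmx_mul trmxK DS.
  (* This vector minimises the quadratic form of [S] over its first coordinate; the minimum is the
     form of the Schur complement. *)
  move=> u u0; have := Spos (col_mx (- (a^-1 *: (r *m u))) u).
  rewrite quad scalerN scalerA divff// scale1r addNr mulmx0 add0r.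
  rewrite [r^T *m _](_ : _ = - (a^-1 *: (r^T *m r)) *m u); last first.
    by rewrite mulmxN mulNmx -scalemxAr -scalemxAl mulmxA.
  rewrite -mulmxDl [_ + D]addrC mulmxA; apply.
  by apply: contra_neq u0 => /(congr1 dsubmx); rewrite col_mxKd linear0.
pose s := Num.sqrt a.
have s0 : 0 < s by rewrite sqrtr_gt0.
have ss : s * s = a by rewrite -expr2 sqr_sqrtr// ltW.
exists (block_mx s%:M (s^-1 *: r) 0 C); split.
- rewrite tr_block_mx mulmx_block !trmx0 !mul0mx !mulmx0 !addr0.
  rewrite !tr_scalar_mx mul_scalar_mx scale_scalar_mx ss.
  rewrite mul_scalar_mx scalerA divff ?gt_eqF// scale1r.
  rewrite (_ : (s^-1 *: r)^T = s^-1 *: r^T); last by rewrite linearZ.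
  rewrite mul_mx_scalar scalerA divff ?gt_eqF// scale1r.
  rewrite -scalemxAl -scalemxAr scalerA -TE -invfM ss addrC subrK.
  exact: SE.
- move=> i j; case: (split_ordP i) => i' ->; case: (split_ordP j) => j' -> /=.
  + by rewrite !ord1.
  + by rewrite ord1.
  + by rewrite block_mxEdl mxE.
  + by rewrite block_mxEdr ltn_add2l => /Ctri.
- move=> i; case: (split_ordP i) => i' ->.
  + by rewrite block_mxEul !ord1 mxE eqxx mulr1n.
  + by rewrite block_mxEdr.
Qed.

Lemma det_cholesky k (C : 'M[R]_k) :
  (forall i j : 'I_k, (j < i)%N -> C i j = 0) ->
  \det (C^T *m C) = (\prod_i C i i) ^+ 2.
Proof.
move=> Ctri; rewrite det_mulmx det_tr -expr2; congr (_ ^+ 2).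
rewrite -det_tr det_trig; first by apply: eq_bigr => i _; rewrite mxE.
by apply/is_trig_mxP => i j ij; rewrite mxE Ctri.
Qed.

Lemma posdef_det_gt0 k (S : 'M[R]_k) : posdef S -> 0 < \det S.
Proof.
move=> /posdef_cholesky[C [-> Ctri Cpos]].
by rewrite det_cholesky// exprn_gt0// prodr_gt0.
Qed.

Lemma posdef_unitmx k (S : 'M[R]_k) : posdef S -> S \in unitmx.
Proof. by move=> /posdef_det_gt0 d0; rewrite unitmxE unitfE gt_eqF. Qed.

Lemma posdef_invmx k (S : 'M[R]_k) : posdef S -> posdef (invmx S).
Proof.
move=> S0; have uS := posdef_unitmx S0.
have -> : invmx S = (invmx S)^T *m S *m invmx S.
  by rewrite trmx_inv S0.1 mulVmx// mul1mx.
by apply: posdef_congr; rewrite // unitmx_inv.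
Qed.

(** With V = C^T C, the trace of V K is that of C K C^T, and [D] is the Cholesky factor of the
    latter. *)
Lemma posdef_mul_cholesky k (V K : 'M[R]_k) : posdef V -> posdef K ->
  exists D : 'M[R]_k, \tr (V *m K) = \sum_i \sum_j D j i ^+ 2 /\
    \det V * \det K = \prod_i D i i ^+ 2.
Proof.
move=> V0 K0; have dV := posdef_det_gt0 V0; case/posdef_cholesky: (V0) => C [VE _ _].
have uC : C^T \in unitmx.
  move: dV; rewrite VE det_mulmx unitmxE unitfE; apply: contraTneq => ->.
  by rewrite mul0r ltxx.
have : posdef (C *m K *m C^T) by rewrite -{1}(trmxK C); exact: posdef_congr.
case/posdef_cholesky => D [DE Dtri _]; exists D; split.
- rewrite VE -mulmxA mxtrace_mulC DE; apply: eq_bigr => i _; rewrite mxE.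
  by apply: eq_bigr => j _; rewrite mxE -expr2.
- rewrite prodrXl -det_cholesky// -DE VE !det_mulmx; ring.
Qed.

Lemma posdef_trace_mul_ge0 k (V K : 'M[R]_k) : posdef V -> posdef K ->
  0 <= \tr (V *m K).
Proof.
move=> V0 K0; have [D [-> _]] := posdef_mul_cholesky V0 K0.
by apply: sumr_ge0 => i _; apply: sumr_ge0 => j _; rewrite sqr_ge0.
Qed.

Lemma det_mul_le_trace k (V K : 'M[R]_k) : posdef V -> posdef K ->
  \det V * \det K <= (\tr (V *m K) / k%:R) ^+ k.
Proof.
move=> V0 K0; have [D [trE ->]] := posdef_mul_cholesky V0 K0.
have le_tr : \sum_(i < k) D i i ^+ 2 <= \tr (V *m K).
  rewrite trE; apply: ler_sum => i _; rewrite (bigD1 i)//=.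
  by rewrite lerDl; apply: sumr_ge0 => j _; rewrite sqr_ge0.
have := @leif_AGM _ _ [pred i : 'I_k | true] (fun i => D i i ^+ 2).
rewrite card_ord => /(_ (fun i _ => sqr_ge0 _)) -[+ _]; move/le_trans; apply.
have sum0 : 0 <= \sum_(i < k) D i i ^+ 2 by apply: sumr_ge0 => i _; exact: sqr_ge0.
rewrite lerXn2r ?nnegrE ?ler_wpM2r ?invr_ge0//.
- exact: divr_ge0.
- by rewrite divr_ge0// (le_trans sum0).
Qed.

End posdef_theory.

(** * The value of the minimisation problem *)

Section Dopt_value.
Context {R : realType}.

(** The constant c of the overview: the scale at which c W^-1 meets the determinant constraint with
    equality. *)
Definition Dstar k (S W : 'M[R]_k) (Rtot : R) : R :=
  (\det S * \det W) `^ (k%:R^-1) * expR (- (2 * Rtot / k%:R)).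

Lemma Dstar_gt0 k (S W : 'M[R]_k) (Rtot : R) :
  posdef S -> posdef W -> 0 < Dstar S W Rtot.
Proof.
by move=> S0 W0; rewrite mulr_gt0 ?expR_gt0 ?powR_gt0 ?mulr_gt0 ?posdef_det_gt0.
Qed.

Lemma DstarX k (S W : 'M[R]_k.+1) (Rtot : R) : posdef S -> posdef W ->
  Dstar S W Rtot ^+ k.+1 = \det S * \det W * expR (- (2 * Rtot)).
Proof.
move=> S0 W0; have d0 : 0 <= \det S * \det W.
  by rewrite ltW// mulr_gt0// posdef_det_gt0.
rewrite exprMn -powR_mulrn ?powR_ge0// -powRrM mulVf// powRr1//.
rewrite -expRM_natl; congr (_ * expR _).
by rewrite mulrN mulrCA divff// mulr1.
Qed.

Lemma feasible_detP k (S K : 'M[R]_k) (Rtot : R) : posdef S -> posdef K ->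
  (2^-1 * ln (\det S / \det K) <= Rtot) =
  (\det S * expR (- (2 * Rtot)) <= \det K).
Proof.
move=> /posdef_det_gt0 S0 /posdef_det_gt0 K0.
rewrite mulrC ler_pdivrMr// [Rtot * 2]mulrC.
rewrite -[ln _ <= _]ler_expR lnK ?posrE ?divr_gt0//.
by rewrite expRN ler_pdivrMr// ler_pdivrMr ?expR_gt0// [_ * expR _]mulrC.
Qed.

Lemma Dstar_le_trace k (S W K : 'M[R]_k.+1) (Rtot : R) : posdef S -> posdef W ->
  posdef K -> \det S * expR (- (2 * Rtot)) <= \det K ->
  k.+1%:R * Dstar S W Rtot <= \tr (W *m K).
Proof.
move=> S0 W0 K0 dK; rewrite -ler_pdivlMl ?ltr0n// mulrC.
rewrite -(@ler_pXn2r _ k.+1)// ?nnegrE ?(ltW (Dstar_gt0 _ _ _))//; last first.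
  by rewrite divr_ge0// posdef_trace_mul_ge0.
apply: le_trans (det_mul_le_trace W0 K0); rewrite DstarX// mulrAC mulrC.
by rewrite ler_pM2l// posdef_det_gt0.
Qed.

(* Superlevel sets of [det] are convex, because [det_mul_le_trace] is an
   equality at [V = K^-1]. *)
Lemma det_convex_ge k (K L : 'M[R]_k.+1) (s delta : R) :
  0 < s -> s < 1 -> 0 < delta -> posdef K -> posdef L ->
  delta <= \det K -> delta <= \det L ->
  delta <= \det ((1 - s) *: K + s *: L).
Proof.
move=> s0 s1 d0 K0 L0 dK dL; set M := _ + _.
have M0 : posdef M.
  apply: posdef_add; first by apply: posdef_scale => //; rewrite subr_gt0.
  exact/posdef_psd/posdef_scale.
have V0 := posdef_invmx M0; have uM := posdef_unitmx M0.
set V := invmx M in V0.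
have dV : 0 < \det V := posdef_det_gt0 V0.
have trM : (1 - s) * (\tr (V *m K) / k.+1%:R) + s * (\tr (V *m L) / k.+1%:R) = 1.
  rewrite !mulrA -mulrDl -!mxtraceZ -mxtraceD 2!scalemxAr -mulmxDr.
  by rewrite mulVmx// mxtrace1 divff.
(* By [trM] the normalised traces of V K and V L have weighted mean 1; a determinant of [M] below
   [delta] would push both above 1. *)
rewrite leNgt; apply/negP => Mdelta.
have Vdelta : 1 < \det V * delta.
  by rewrite det_inv mulrC ltr_pdivlMr ?mul1r// posdef_det_gt0.
have gt1 A : posdef A -> delta <= \det A -> 1 < \tr (V *m A) / k.+1%:R.
  move=> A0 dA; rewrite -(@ltr_pXn2r _ k.+1)// ?nnegrE//; last first.
    by rewrite divr_ge0// posdef_trace_mul_ge0.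
  rewrite expr1n (lt_le_trans Vdelta)// (le_trans _ (det_mul_le_trace V0 A0))//.
  by rewrite ler_pM2l.
have := gt1 _ K0 dK; have := gt1 _ L0 dL; move: trM.
set x := _ / _; set y := _ / _ => + y1 x1.
have : 0 < (1 - s) * (x - 1) by rewrite mulr_gt0 ?subr_gt0.
have : 0 < s * (y - 1) by rewrite mulr_gt0 ?subr_gt0.
lra.
Qed.

Lemma quad_sum k (N : 'M[R]_k) (y : 'cV[R]_k) :
  (y^T *m N *m y) 0 0 = \sum_i \sum_j N i j * (y i 0 * y j 0).
Proof.
rewrite mxE exchange_big /=; apply: eq_bigr => j _; rewrite mxE mulr_suml.
by apply: eq_bigr => i _; rewrite mxE; ring.
Qed.

Lemma quad_le k (N : 'M[R]_k) (y : 'cV[R]_k) :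
  (y^T *m N *m y) 0 0 <= (\sum_i \sum_j `|N i j|) * (y^T *m y) 0 0.
Proof.
have yE : (y^T *m y) 0 0 = \sum_l y l 0 ^+ 2.
  by rewrite mxE; apply: eq_bigr => l _; rewrite mxE expr2.
have le1 i : y i 0 ^+ 2 <= \sum_l y l 0 ^+ 2.
  by rewrite (bigD1 i)//= lerDl sumr_ge0// => l _; exact: sqr_ge0.
rewrite quad_sum yE mulr_suml; apply: ler_sum => i _; rewrite mulr_suml.
apply: ler_sum => j _; apply: le_trans (ler_norm _) _; rewrite normrM ler_wpM2l//.
have := le1 i; have := le1 j; set T := \sum_l _ => Tj Ti.
rewrite ler_norml.
have := sqr_ge0 (y i 0 + y j 0); have := sqr_ge0 (y i 0 - y j 0).
rewrite sqrrB sqrrD => h1 h2; apply/andP; split; lra.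
Qed.

(** Congruence by the Cholesky factor of [P] reduces [P] to the identity and [K] to [N], whose
    quadratic form is at most B |y|^2 by [quad_le]. In the application [P] is the gap S - K*, and
    [s] the length of a move that stays below S. *)
Lemma posdef_absorb k (P K : 'M[R]_k) : posdef P -> K^T = K ->
  exists2 s, 0 < s < 1 & psd (P - s *: K).
Proof.
move=> P0 Ks; case/posdef_cholesky: (P0) => C [PE _ _].
have uC : C \in unitmx.
  have := posdef_unitmx P0; rewrite PE !unitmxE det_mulmx det_tr !unitfE.
  by rewrite mulf_eq0 orbb.
pose N := (invmx C)^T *m K *m invmx C.
pose B := \sum_i \sum_j `|N i j|.
have B0 : 0 <= B by apply: sumr_ge0 => i _; apply: sumr_ge0.
have B1 : 1 < 2 + B by lra.
have B2 : 0 < 2 + B by lra.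
(* The summand 2 keeps the quotient defined and strictly below 1 even when B = 0. *)
exists (2 + B)^-1; first by rewrite invr_gt0 invf_lt1 ?B2.
split; first by rewrite linearB /= linearZ /= Ks P0.1.
move=> u; rewrite mulmxBr mulmxBl mxE [X in _ + X]mxE subr_ge0.
rewrite -scalemxAr -scalemxAl mxE.
have -> : u^T *m K *m u = (C *m u)^T *m N *m (C *m u).
  rewrite /N -!mulmxA (mulmxA (invmx C)) mulVmx// mul1mx !mulmxA -trmx_mul.
  by rewrite mulmxA mulVmx// mul1mx.
have -> : u^T *m P *m u = (C *m u)^T *m (C *m u) by rewrite PE trmx_mul !mulmxA.
rewrite ler_pdivrMl; last lra.
apply: le_trans (quad_le _ _) _; rewrite ler_wpM2r//; last by rewrite -/B; lra.
by rewrite mxE sumr_ge0// => i _; rewrite mxE -expr2 sqr_ge0.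
Qed.

Lemma inf_min (E : set R) (m : R) : E m -> lbound E m -> inf E = m.
Proof.
move=> Em lb; apply/eqP; rewrite eq_le; apply/andP; split.
  by apply: ge_inf => //; exists m.
by apply: lb_le_inf => //; exists m.
Qed.

Lemma Dopt_interior k (S W : 'M[R]_k.+1) (Rtot : R) : posdef S ->
  interior_regime S W Rtot -> Dopt S W Rtot = k.+1%:R * Dstar S W Rtot.
Proof.
move=> S0 [W0 [K [[[K0 KS KR] Kmin] KltS]]].
have -> : Dopt S W Rtot = \tr (W *m K).
  by apply: inf_min => [|_ [K' K'f <-]]; [exists K|exact: Kmin].
have dK : \det S * expR (- (2 * Rtot)) <= \det K by rewrite -feasible_detP.
apply/eqP; rewrite eq_le; apply/andP; split; last exact: Dstar_le_trace.
pose c := Dstar S W Rtot; have c0 : 0 < c := Dstar_gt0 _ S0 W0.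
(* [L] attains the trace bound under the determinant constraint, but nothing places it below [S]. *)
pose L := c *: invmx W.
have L0 : posdef L by apply: posdef_scale => //; exact: posdef_invmx.
have uW := posdef_unitmx W0; have dW := posdef_det_gt0 W0.
have dL : \det S * expR (- (2 * Rtot)) <= \det L.
  by rewrite detZ det_inv DstarX// mulrAC mulfK// gt_eqF.
have trL : \tr (W *m L) = k.+1%:R * c.
  by rewrite -scalemxAr mulmxV// mxtraceZ mxtrace1 mulrC.
clearbody L.
have [s /andP[s0 s1] sP] := posdef_absorb KltS L0.1.
have delta0 : 0 < \det S * expR (- (2 * Rtot)).
  by rewrite mulr_gt0 ?expR_gt0 ?posdef_det_gt0.
have dKL := det_convex_ge s0 s1 delta0 K0 L0 dK dL.
have KL0 : posdef ((1 - s) *: K + s *: L).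
  apply: posdef_add; first by apply: posdef_scale => //; rewrite subr_gt0.
  exact/posdef_psd/posdef_scale.
have /Kmin : feasible S Rtot ((1 - s) *: K + s *: L).
  split => //; last by rewrite feasible_detP.
  (* The gap below [S] splits into s K, positive definite, and S - K - s L, nonnegative by the
     choice of [s]. *)
  rewrite /loewner_le (_ : _ - _ = s *: K + (S - K - s *: L)).
    by apply/posdef_psd/posdef_add => //; exact: posdef_scale.
  by rewrite scalerBl scale1r; apply/matrixP => i j; rewrite !mxE; ring.
rewrite mulmxDr mxtraceD -!scalemxAr !mxtraceZ trL => h.
rewrite -(ler_pM2l s0) -/c; move: h; set x := \tr _; set y := _ * c => h.
by rewrite -subr_ge0; move: h; rewrite -subr_ge0; congr (0 <= _); ring.
Qed.

End Dopt_value.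

(** * Densities and conditional expectations *)

Section densities.
Context {d : measure_display} {T : measurableType d} {R : realType}.
Local Open Scope ereal_scope.

(** A real-valued version, nonnegative everywhere, so that products, composites and logarithms of
    densities are plain functions. *)
Definition has_density (mu nu : set T -> \bar R) (r : T -> R) :=
  [/\ measurable_fun setT r, forall x, (0 <= r x)%R &
      forall A, measurable A -> mu A = \int[nu]_(x in A) (r x)%:E].

Lemma has_density_dominates (mu : set T -> \bar R)
    (nu : {measure set T -> \bar R}) (r : T -> R) :
  has_density mu nu r -> mu `<< nu.
Proof.
move=> [mr _ muE]; apply/null_content_dominatesP => A mA nuA0.
rewrite muE//; apply: null_set_integral => //.
exact/measurable_EFinP/measurable_funTS.
Qed.

(** [r] and the Radon-Nikodym derivative have the same integral over every measurable set, so they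
    agree [nu]-almost everywhere. *)
Lemma ge0_integral_density (mu : {finite_measure set T -> \bar R})
    (nu : {sigma_finite_measure set T -> \bar R}) (r : T -> R) (h : T -> \bar R) :
  has_density mu nu r -> measurable_fun setT h -> (forall x, 0 <= h x) ->
  \int[mu]_x h x = \int[nu]_x (h x * (r x)%:E).
Proof.
move=> dr mh h0; have munu := has_density_dominates dr; case: dr => mr r0 muE.
rewrite -(Radon_Nikodym_SigmaFinite.change_of_variables munu)//.
have mf := measurable_int _ (Radon_Nikodym_SigmaFinite.f_integrable munu).
apply: ge0_ae_eq_integral => //.
- exact: emeasurable_funM.
- by apply: emeasurable_funM => //; exact/measurable_EFinP.
- by move=> x _; rewrite mule_ge0// Radon_Nikodym_SigmaFinite.f_ge0.
- by move=> x _; rewrite mule_ge0// lee_fin.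
apply: ae_eqe_mul2l; apply: integral_ae_eq => //.
- exact: Radon_Nikodym_SigmaFinite.f_integrable.
- exact/measurable_EFinP.
- by move=> E _ mE; rewrite -Radon_Nikodym_SigmaFinite.f_integral// muE.
Qed.

Lemma radon_nikodym_density (mu : {finite_measure set T -> \bar R})
    (nu : {sigma_finite_measure set T -> \bar R}) : mu `<< nu ->
  exists2 r : T -> R, has_density mu nu r &
    ae_eq nu setT (EFin \o r) (Radon_Nikodym (charge_of_finite_measure mu) nu).
Proof.
move=> munu; pose f := Radon_Nikodym_SigmaFinite.f mu nu.
have fE x : (fine (f x))%:E = f x.
  by rewrite fineK// Radon_Nikodym_SigmaFinite.f_fin_num.
have mf := measurable_int _ (Radon_Nikodym_SigmaFinite.f_integrable munu).
exists (fine \o f).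
  split.
  - by apply/measurable_EFinP; apply: eq_measurable_fun mf => x _; exact/esym/fE.
  - by move=> x; rewrite /= fine_ge0// Radon_Nikodym_SigmaFinite.f_ge0.
  - move=> A mA; rewrite (Radon_Nikodym_SigmaFinite.f_integral munu)//.
    by apply: eq_integral => x _; rewrite fE.
have -> : EFin \o (fine \o f) = f by apply/funext => x; exact: fE.
exact: ae_eq_Radon_Nikodym_SigmaFinite.
Qed.

Lemma integral_frestr (mu : {finite_measure set T -> \bar R}) (D : set T)
    (mD : measurable D) (Doo : mu D < +oo) (h : T -> \bar R) :
  measurable_fun setT h -> (forall x, 0 <= h x) ->
  \int[mfrestr mD Doo]_x h x = \int[mu]_(x in D) h x.
Proof.
move=> mh h0; rewrite (@ge0_integral_density _ mu \1_D)//.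
  rewrite -[in RHS](setTI D) integral_mkcondr; apply: eq_integral => x _.
  by rewrite epatch_indic.
by split => // A mA; rewrite integral_indic// setIC.
Qed.

End densities.

Definition fimage_measure d d' (T : measurableType d) (T' : measurableType d')
  (R : realType) (mu : {finite_measure set T -> \bar R}) (X : {mfun T >-> T'}) :=
  pushforward mu X.

Section fimage_measure_is_finite_measure.
Context d d' {T : measurableType d} {T' : measurableType d'} {R : realType}.
Variables (mu : {finite_measure set T -> \bar R}) (X : {mfun T >-> T'}).
Local Open Scope ereal_scope.

Let image0 : fimage_measure mu X set0 = 0. Proof. exact: measure0. Qed.

Let image_ge0 A : 0 <= fimage_measure mu X A. Proof. exact: measure_ge0. Qed.

Let image_sigma_additive : semi_sigma_additive (fimage_measure mu X).
Proof. exact: measure_semi_sigma_additive. Qed.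

HB.instance Definition _ := isMeasure.Build _ _ _ (fimage_measure mu X)
  image0 image_ge0 image_sigma_additive.

Let image_fin : fin_num_fun (fimage_measure mu X).
Proof. by move=> A mA; apply: fin_num_measure; exact: measurable_funPTI. Qed.

HB.instance Definition _ :=
  Measure_isFinite.Build _ _ _ (fimage_measure mu X) image_fin.

Lemma ge0_integral_fimage_measure (h : T' -> \bar R) :
  measurable_fun setT h -> (forall y, 0 <= h y) ->
  \int[fimage_measure mu X]_y h y = \int[mu]_x h (X x).
Proof. by move=> mh h0; rewrite ge0_integral_pushforward. Qed.

End fimage_measure_is_finite_measure.

Section conditional_expectation.
Context {d : measure_display} {Omega : measurableType d} {R : realType}.
Variable P : probability Omega R.
Context {dU : measure_display} {SU : measurableType dU}.
Variable U : {RV P >-> SU}.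
Local Open Scope ereal_scope.

Let mpre C : measurable C -> measurable (U @^-1` C).
Proof. by move=> mC; exact: measurable_funPTI. Qed.

(** [r u] is P(E | U = u), obtained as the density of the image under [U] of [P] restricted to [E],
    with respect to the law of [U]. *)
Lemma cond_prob_density (E : set Omega) : measurable E ->
  exists r : SU -> R, [/\ measurable_fun setT r, forall u, (0 <= r u)%R,
   (forall h, measurable_fun setT h -> (forall u, 0 <= h u) ->
    \int[P]_(w in E) h (U w) = \int[distribution P U]_u (h u * (r u)%:E)) &
   (forall C, measurable C ->
     P (E `&` U @^-1` C) = \int[distribution P U]_(u in C) (r u)%:E)].
Proof.
move=> mE; have Eoo : P E < +oo by rewrite (le_lt_trans (probability_le1 P mE))// ltry.
pose m := fimage_measure (mfrestr mE Eoo) U.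
have mP : m `<< distribution P U.
  apply/null_content_dominatesP => C mC C0; apply/eqP.
  rewrite eq_le measure_ge0 andbT -[leRHS]C0.
  by apply: measureIl => //; exact: mpre.
have [r dr _] := radon_nikodym_density mP.
exists r; case: (dr) => mr r0 rE; split => // [h mh h0|C mC].
  rewrite -(ge0_integral_density dr)// ge0_integral_fimage_measure//.
  by rewrite integral_frestr//; exact: measurableT_comp.
by rewrite setIC -rE.
Qed.

Lemma condexp_is_condexp (f : Omega -> R) (g : SU -> R) :
  is_condexp U f g -> is_condexp U f (condexp U f).
Proof. by move=> gP; apply: xgetPex; exists g. Qed.

Lemma condexp_indic (E : set Omega) (r : SU -> R) : measurable E ->
  measurable_fun setT r -> (forall u, (0 <= r u)%R) ->
  (forall C, measurable C ->
     P (E `&` U @^-1` C) = \int[distribution P U]_(u in C) (r u)%:E) ->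
  ae_eq (distribution P U) setT (EFin \o condexp U \1_E) (EFin \o r).
Proof.
move=> mE mr r0 rE.
have mrE : measurable_fun setT (EFin \o r) by exact/measurable_EFinP.
have intr C : measurable C ->
    \int[P]_(w in U @^-1` C) (r (U w))%:E = P (E `&` U @^-1` C).
  move=> mC; rewrite rE//= ge0_integral_pushforward//; first exact: measurable_funTS.
  by move=> u _; rewrite lee_fin.
have : is_condexp U \1_E r.
  split => //.
  - apply/integrableP; split; first exact: measurableT_comp.
    under eq_integral do rewrite /= ger0_norm//.
    have := intr _ measurableT; rewrite preimage_setT setIT => ->.
    by rewrite (le_lt_trans (probability_le1 P mE))// ltry.
  - move=> C mC; rewrite intr// integral_indic//; exact: mpre.
move/condexp_is_condexp; set g := condexp _ _ => -[mg ig gE].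
have mgE : measurable_fun setT (EFin \o g) by exact/measurable_EFinP.
apply: ae_eq_sym; apply: integral_ae_eq => //.
- apply/integrableP; split => //.
  under eq_integral do rewrite /= ger0_norm//.
  by rewrite -rE// (le_lt_trans (probability_le1 P _))// ?ltry// preimage_setT setIT.
- move=> C _ mC; rewrite -rE//= integral_pushforward//=.
    rewrite gE// integral_indic//; exact: mpre.
  by apply: (integrableS measurableT) => //; exact: mpre.
Qed.

(* On the layer [n <= g < n + 1] one has
   [g^2 + 4 n f <= 2 f^2 + 2 + 4 n g], and [f], [g] have the same integral. *)
Lemma condexp_layer (f : Omega -> R) (g : SU -> R) (n : nat) (F : set Omega) :
  F = U @^-1` (g @^-1` `[n%:R, n.+1%:R[) ->
  P.-integrable setT (EFin \o (fun w => f w ^+ 2)%R) ->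
  P.-integrable setT (EFin \o f) -> is_condexp U f g ->
  \int[P]_(w in F) (g (U w) ^+ 2)%:E <= \int[P]_(w in F) (2 * f w ^+ 2 + 2)%:E.
Proof.
move=> FE if2 if1 [mg ig gE].
have mC : measurable (g @^-1` `[n%:R, n.+1%:R[).
  by rewrite -[X in measurable X]setTI; exact: mg.
have mF : measurable F by rewrite FE; exact: mpre.
have F2 : P.-integrable F (EFin \o (fun w => f w ^+ 2)%R) by exact: integrableS if2.
have F1 : P.-integrable F (EFin \o f) by exact: integrableS if1.
have G1 : P.-integrable F (EFin \o g \o U) by exact: integrableS ig.
have Fc (c : R) : P.-integrable F (EFin \o cst c).
  exact: finite_measure_integrable_cst.
have gF w : F w -> (n%:R <= g (U w) < n%:R + 1)%R.
  by rewrite FE /= in_itv /= -natr1.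
have G2 : P.-integrable F (EFin \o (fun w => g (U w) ^+ 2)%R).
  apply: (le_integrable mF _ _ (Fc ((n%:R + 1) ^+ 2)%R)).
    apply/measurable_EFinP/measurable_funTS/measurable_funX.
    exact: measurableT_comp.
  move=> w /gF /andP[g1 g2]; rewrite /= lee_fin !ger0_norm ?sqr_ge0//.
  by rewrite lerXn2r ?nnegrE ?(ltW g2)// (le_trans _ g1).
have H : P.-integrable F (EFin \o (fun w => 2 * f w ^+ 2 + 2)%R).
  by have := integrableD mF (integrableZl mF 2 F2) (Fc 2%R).
have Fn : P.-integrable F (fun w => (4 * n%:R)%:E * (f w)%:E).
  exact: integrableZl F1.
have Gn : P.-integrable F (fun w => (4 * n%:R)%:E * (g (U w))%:E).
  exact: integrableZl G1.
have fin : \int[P]_(w in F) ((4 * n%:R)%:E * (f w)%:E) \is a fin_num.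
  exact: integrable_fin_num.
rewrite -(leeD2rE _ _ fin).
have fgE : \int[P]_(w in F) ((4 * n%:R)%:E * (f w)%:E) =
           \int[P]_(w in F) ((4 * n%:R)%:E * (g (U w))%:E).
  by rewrite !integralZl// FE gE.
rewrite -integralD// fgE -integralD//.
apply: le_integral => //; [exact: integrableD|exact: integrableD|].
move=> w; rewrite inE => /gF /andP[g1 g2].
rewrite -!EFinM -!EFinD lee_fin.
have n0 : (0 <= n%:R :> R)%R by [].
(* By 2 (f - n)^2 >= 0 it is enough that g^2 - 4 n g <= 2 - 2 n^2, which holds for g in [n, n +
   1). *)
have := sqr_ge0 (f w - n%:R)%R; nra.
Qed.

(** On each layer [g] is bounded, so every integral compared is finite; the bound 2 f^2 + 2 does not
    depend on the layer, so the layers together stay below its total integral. *)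
Lemma condexp_sqr_ge0_part (f : Omega -> R) (g : SU -> R) :
  P.-integrable setT (EFin \o (fun w => f w ^+ 2)%R) ->
  P.-integrable setT (EFin \o f) -> is_condexp U f g ->
  \int[P]_(w in U @^-1` (g @^-1` `[0%R, +oo[)) (g (U w) ^+ 2)%:E < +oo.
Proof.
move=> if2 if1 gf; have [mg ig gE] := gf.
pose F n := U @^-1` (g @^-1` `[n%:R, n.+1%:R[).
have mF n : measurable (F n).
  by apply: mpre; rewrite -[X in measurable X]setTI; exact: mg.
have UF : U @^-1` (g @^-1` `[0%R, +oo[) = \bigcup_n F n.
  apply/seteqP; split => w /=; rewrite in_itv/= ?andbT.
    move=> g0; exists (Num.truncn (g (U w))) => //; rewrite /F/= in_itv/=.
    by rewrite truncnS_gt andbT truncn_le.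
  by move=> [n _]; rewrite /F/= in_itv/= => /andP[+ _]; exact: le_trans.
have tF : trivIset setT F.
  apply/trivIsetP => i j _ _ ij; apply/seteqP; split => // w [].
  rewrite /F/= !in_itv/= => /andP[i1 i2] /andP[j1 j2].
  have : (i < j.+1)%N by rewrite -(ltr_nat R) (le_lt_trans i1).
  have : (j < i.+1)%N by rewrite -(ltr_nat R) (le_lt_trans j1).
  by rewrite !ltnS => h1 h2; move/eqP: ij; apply; apply/eqP; rewrite eqn_leq h1 h2.
have mg2 : measurable_fun setT (fun w => (g (U w) ^+ 2)%:E).
  by apply/measurable_EFinP/measurable_funX; exact: measurableT_comp.
have H : P.-integrable setT (EFin \o (fun w => 2 * f w ^+ 2 + 2)%R).
  have Fc : P.-integrable setT (EFin \o cst 2%R).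
    exact: finite_measure_integrable_cst.
  by have := integrableD measurableT (integrableZl measurableT 2 if2) Fc.
have H0 w : (0 <= 2 * f w ^+ 2 + 2)%R by rewrite addr_ge0// mulr_ge0// sqr_ge0.
have mU : measurable (\bigcup_n F n) by exact: bigcupT_measurable.
rewrite UF ge0_integral_bigcup//; first last.
- by move=> w _; rewrite lee_fin sqr_ge0.
- exact: measurable_funTS.
apply: (@le_lt_trans _ _ (\int[P]_w (2 * f w ^+ 2 + 2)%:E)); last first.
  exact: integrable_lty H.
apply: (@le_trans _ _ (\int[P]_(w in \bigcup_n F n) (2 * f w ^+ 2 + 2)%:E)).
  rewrite ge0_integral_bigcup//; first last.
  - by move=> w _; rewrite lee_fin.
  - exact/measurable_funTS/(measurable_int _ H).
  apply: lee_nneseries => [n _ _|n _].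
    by apply: integral_ge0 => w _; rewrite lee_fin sqr_ge0.
  exact: condexp_layer.
apply: ge0_subset_integral => //; first exact: measurable_int H.
by move=> w _; rewrite lee_fin.
Qed.

Lemma condexp_sqr_integrable (f : Omega -> R) :
  measurable_fun setT f -> P.-integrable setT (EFin \o (fun w => f w ^+ 2)%R) ->
  P.-integrable setT (EFin \o (fun w => condexp U f (U w) ^+ 2)%R).
Proof.
(* If no version exists, [condexp] is the default 0. *)
move=> mf if2; rewrite /condexp; case: xgetP => [g _ gf|_]; last first.
  rewrite (_ : _ \o _ = EFin \o cst (0 ^+ 2)%R)//.
  exact: finite_measure_integrable_cst.
have if1 : P.-integrable setT (EFin \o f).
  have Fc : P.-integrable setT (EFin \o cst 1%R).
    exact: finite_measure_integrable_cst.
  have H := integrableD measurableT if2 Fc.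
  apply: (le_integrable measurableT _ _ H); first exact/measurable_EFinP.
  move=> w _ /=; rewrite lee_fin [leRHS]ger0_norm ?addr_ge0 ?sqr_ge0//.
  have := sqr_ge0 (f w - 1)%R; have := sqr_ge0 (f w + 1)%R.
  by rewrite ler_norml => h1 h2; apply/andP; split; nra.
have [mg ig gE] := gf.
(* The region g < 0 is handled by passing to -f and -g. *)
have gNf : is_condexp U (\- f)%R (\- g)%R.
  split; first exact: measurableT_comp.
    by have := integrableN ig.
  move=> C mC; have mUC := mpre mC.
  under eq_integral do rewrite /= EFinN.
  rewrite integralN/=; last first.
    by apply: integrable_add_def => //; exact: integrableS ig.
  under [RHS]eq_integral do rewrite /= EFinN.
  rewrite integralN/=; last first.
    by apply: integrable_add_def => //; exact: integrableS if1.
  by rewrite gE.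
have mg2 : measurable_fun setT (fun w => (g (U w) ^+ 2)%:E).
  by apply/measurable_EFinP/measurable_funX; exact: measurableT_comp.
apply/integrableP; split => //.
under eq_integral do rewrite /= ger0_norm ?sqr_ge0//.
pose A := U @^-1` (g @^-1` `[0%R, +oo[).
have mA : measurable A by apply: mpre; rewrite -[X in measurable X]setTI; exact: mg.
rewrite -(setUv A) integral_setU//=; [|exact: measurableC| |by apply/disj_setPS => w []].
- apply: lte_add_pinfty; first exact: condexp_sqr_ge0_part gf.
  have if2N : P.-integrable setT (EFin \o (fun w => (\- f)%R w ^+ 2)%R).
    by apply: eq_integrable if2 => // w _; rewrite /= sqrrN.
  have if1N : P.-integrable setT (EFin \o (\- f)%R).
    by have := integrableN if1.
  have := condexp_sqr_ge0_part if2N if1N gNf; apply: le_lt_trans.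
  under [leRHS]eq_integral do rewrite /= sqrrN.
  apply: ge0_subset_integral => //.
  + exact: measurableC.
  + by apply: mpre; rewrite -[X in measurable X]setTI; have [mNg _ _] := gNf; exact: mNg.
  + exact: measurable_funTS.
  + by move=> w _; rewrite lee_fin sqr_ge0.
  + by move=> w; rewrite /A/= !in_itv/= !andbT oppr_ge0 => /negP; rewrite -ltNge => /ltW.
- exact: measurable_funTS.
Qed.

End conditional_expectation.

(** * Information bounds and the chain rule *)

Section density_measure.
Context {d : measure_display} {T : measurableType d} {R : realType}.
Variables (nu : {measure set T -> \bar R}) (r : T -> R).
Hypotheses (mr : measurable_fun setT r) (r0 : forall x, 0 <= r x).
Local Open Scope ereal_scope.

(* The two proofs are arguments so that the measure instance can be inferred. *)
Definition density_measure of measurable_fun setT r & (forall x, (0 <= r x)%R) :=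
  fun A : set T => \int[nu]_(x in A) (r x)%:E.

Local Notation m := (density_measure mr r0).

Let m_0 : m set0 = 0. Proof. exact: integral_set0. Qed.

Let m_ge0 A : 0 <= m A.
Proof. by apply: integral_ge0 => x _; rewrite lee_fin. Qed.

Let m_sigma_additive : semi_sigma_additive m.
Proof.
move=> F mF tF mUF; rewrite /m /density_measure ge0_integral_bigcup//.
- by apply: is_cvg_ereal_nneg_natsum_cond => n _ _; exact: m_ge0.
- exact/measurable_EFinP/measurable_funTS.
- by move=> x _; rewrite lee_fin.
Qed.

HB.instance Definition _ := isMeasure.Build _ _ _ m m_0 m_ge0 m_sigma_additive.

End density_measure.

(** * Uniqueness of finite measures that agree on rectangles *)

Section uniqueness_on_rectangles.
Context {d1 d2 : measure_display} {T1 : measurableType d1}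
  {T2 : measurableType d2} {R : realType}.
Local Open Scope ereal_scope.

Lemma measure_eq_rect (m1 m2 : {measure set (T1 * T2)%type -> \bar R}) :
  m1 setT < +oo ->
  (forall A B, measurable A -> measurable B -> m1 (A `*` B) = m2 (A `*` B)) ->
  forall D, measurable D -> m1 D = m2 D.
Proof.
move=> m1oo m12 D mD.
pose G : set (set (T1 * T2)%type) :=
  [set A `*` B | A in measurable & B in measurable].
apply: (measure_unique G (fun=> setT)) => //.
- by rewrite measurable_prod_measurableType.
- move=> _ _ [A1 mA1 [A2 mA2 <-]] [B1 mB1 [B2 mB2 <-]].
  exists (A1 `&` B1); first exact: measurableI.
  by exists (A2 `&` B2); [exact: measurableI|rewrite setXI].
- by move=> _; exists setT => //; exists setT => //; rewrite setXTT.
- by apply/seteqP; split => // x _; exists 0%N.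
- by move=> _ [A mA [B mB <-]]; exact: m12.
Qed.

End uniqueness_on_rectangles.

Section uniqueness_on_triple_rectangles.
Context {d1 d2 d3 : measure_display} {T1 : measurableType d1}
  {T2 : measurableType d2} {T3 : measurableType d3} {R : realType}.
Local Open Scope ereal_scope.

(** The rectangle argument is used twice: with [A] fixed, the restrictions of both measures to [A]
    times everything, pushed to the last two factors, are finite measures that agree on rectangles
    there. *)
Lemma measure_eq_rect3 (m1 : {finite_measure set (T1 * (T2 * T3))%type -> \bar R})
    (m2 : {measure set (T1 * (T2 * T3))%type -> \bar R}) :
  (forall A B C, measurable A -> measurable B -> measurable C ->
     m1 (A `*` (B `*` C)) = m2 (A `*` (B `*` C))) ->
  forall D, measurable D -> m1 D = m2 D.
Proof.
move=> m12; apply: measure_eq_rect => [|A E mA mE].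
  by rewrite -ge0_fin_numE ?fin_num_measure.
have mAT : measurable (A `*` [set: (T2 * T3)%type]) by exact: measurableX.
have oo1 : m1 (A `*` setT) < +oo by rewrite -ge0_fin_numE ?fin_num_measure.
have oo2 : m2 (A `*` setT) < +oo by rewrite -setXTT -m12// setXTT.
have msnd : measurable_fun setT (snd : T1 * (T2 * T3) -> T2 * T3)%type.
  exact: measurable_snd.
pose snd' : {mfun (T1 * (T2 * T3))%type >-> (T2 * T3)%type} :=
  HB.pack (snd : T1 * (T2 * T3) -> T2 * T3)%type
    (isMeasurableFun.Build _ _ _ _ _ msnd).
have preE F : A `*` F = snd' @^-1` F `&` (A `*` setT).
  by apply/seteqP; split => [[x y] []|[x y] []] //= ? [].
rewrite (preE E).
suff : fimage_measure (mfrestr mAT oo1) snd' E =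
       fimage_measure (mfrestr mAT oo2) snd' E by [].
apply: measure_eq_rect => //.
 by rewrite -ge0_fin_numE ?fin_num_measure.
 move=> B C mB mC; have := m12 A B C mA mB mC; rewrite (preE (B `*` C)); exact.
Qed.

End uniqueness_on_triple_rectangles.

Section divergence.
Context {d : measure_display} {T : measurableType d} {R : realType}.
Local Open Scope ereal_scope.

(** The set where [r] vanishes has [mu]-mass the integral of 0, whatever its [nu]-mass. Hence the
    logarithm of a product of densities splits [mu]-almost everywhere. *)
Lemma has_density_ae_gt0 (mu nu : {measure set T -> \bar R}) (r : T -> R) :
  has_density mu nu r -> {ae mu, forall x, (0 < r x)%R}.
Proof.
move=> [mr r0 muE]; exists (r @^-1` [set 0%R]); split.
- by rewrite -[X in measurable X]setTI; exact: mr.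
- rewrite muE; last by rewrite -[X in measurable X]setTI; exact: mr.
  by apply: integral0_eq => x rx0; rewrite (rx0 : r x = 0%R).
- move=> x /= /negP; rewrite -leNgt => rx0; apply/eqP.
  by rewrite eq_le rx0 r0.
Qed.

Lemma integrable_of_neg (mu : {measure set T -> \bar R}) (f : T -> \bar R) :
  measurable_fun setT f -> \int[mu]_x f^\- x < +oo -> \int[mu]_x f x < +oo ->
  mu.-integrable setT f.
Proof.
move=> mf fn; rewrite integralE => f_lt; apply/integrableP; split => //.
have fp : \int[mu]_x f^\+ x < +oo.
  move: f_lt fn; have : 0 <= \int[mu]_x f^\- x by exact: integral_ge0.
  case: (\int[mu]_x f^\- x) => [b| |] // _.
  by case: (\int[mu]_x f^\+ x) => [a| |] //= _ _; rewrite ltry.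
under eq_integral do rewrite -/((abse \o f) _) fune_abse.
rewrite ge0_integralD//; first exact: lte_add_pinfty.
- exact: measurable_funepos.
- exact: measurable_funeneg.
Qed.

(* The negative part of [ln r] is at most [1 / r], whose [mu]-integral is at
   most [1]. *)
Lemma integral_ln_density_neg (mu nu : probability T R) (r : T -> R) :
  has_density mu nu r -> \int[mu]_x (EFin \o (fun x => ln (r x)))^\- x <= 1.
Proof.
move=> dr; have [mr r0 muE] := dr.
have mV : measurable_fun setT (fun x => r x `^ (-1))%R.
  exact: measurableT_comp (measurable_powR (-1)%R) mr.
apply: (@le_trans _ _ (\int[mu]_x (r x `^ (-1))%:E)).
  apply: ge0_le_integral => //.
  - by apply: measurable_funeneg; apply/measurable_EFinP; exact: measurableT_comp.
  - exact/measurable_EFinP.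
  - move=> x _; rewrite funenegE /= -EFin_max lee_fin ge_max powR_ge0 andbT.
    have := r0 x; rewrite le_eqVlt => /orP[/eqP<-|rx].
      by rewrite ln0// oppr0 powR_ge0.
    rewrite powR_inv1 ?ltW// -lnV ?posrE//.
    by apply: ln_sublinear; rewrite invr_gt0.
rewrite (ge0_integral_density dr)//; last 2 first.
- exact/measurable_EFinP.
- by move=> x; rewrite lee_fin powR_ge0.
apply: (@le_trans _ _ (\int[nu]_x (cst 1 x))); last first.
  by rewrite integral_cst//= probability_setT mule1.
apply: ge0_le_integral => //.
- by move=> x _; rewrite mule_ge0// lee_fin ?powR_ge0.
- by apply: emeasurable_funM; exact/measurable_EFinP.
- move=> x _; rewrite /= -EFinM lee_fin powR_inv1//.
  by have [->|rx] := eqVneq (r x) 0%R; rewrite ?mulr0// mulVf.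
Qed.

(** The strict bound excludes the [+oo] branch, which gives domination; since the negative part of
    ln r has integral at most 1, a bound from above then makes ln r integrable. *)
Lemma kl_density (mu nu : probability T R) (c : R) : kl mu nu < c%:E ->
  exists r : T -> R, [/\ has_density mu nu r,
    mu.-integrable setT (EFin \o (fun x => ln (r x))) &
    \int[mu]_x (ln (r x))%:E < c%:E].
Proof.
rewrite /kl; case: asboolP => [munu|//].
have [r dr rE] := radon_nikodym_density munu; have [mr r0 muE] := dr.
set f := Radon_Nikodym _ _ in rE *.
have mf : measurable_fun setT f.
  exact/(measurable_int nu)/Radon_Nikodym_integrable.
have mff : measurable_fun setT (fine \o f) by exact: measurableT_comp.
have ff x : f x = (fine (f x))%:E by rewrite fineK// Radon_Nikodym_fin_num.
have mln : measurable_fun setT (EFin \o (fun x => ln (r x))).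
  by apply/measurable_EFinP; exact: measurableT_comp.
have -> : \int[mu]_x lne (f x) = \int[mu]_x (ln (r x))%:E.
  (* [lne] is -oo at 0 while [ln] is 0 there; the two integrands agree where r > 0, hence
     [mu]-almost everywhere. *)
  apply: ae_eq_integral => //.
    rewrite (_ : (fun x => lne (f x)) = fun x =>
      if (fine (f x) <= 0)%R then -oo else (ln (fine (f x)))%:E); last first.
      by apply/funext => x; rewrite {1}ff.
    apply: measurable_fun_ifT => //; first exact: measurable_fun_ler.
    by apply/measurable_EFinP; exact: measurableT_comp.
  have := null_dominates_ae_eq measurableT munu rE.
  have := has_density_ae_gt0 dr; apply: filterS2 => x rx /(_ I) /= <- _.
  by rewrite lne_EFin.
move=> lt_c; exists r; split => //; apply: integrable_of_neg => //.
- by apply: le_lt_trans (integral_ln_density_neg dr) _; rewrite ltry.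
- exact: lt_trans lt_c (ltry _).
Qed.

End divergence.

Section information_bound.
Context {d : measure_display} {Omega : measurableType d} {R : realType}.
Variable P : probability Omega R.
Local Open Scope ereal_scope.

Definition indep_law {d1 d2} {SX : measurableType d1} {SU : measurableType d2}
  (X : {RV P >-> SX}) (U : {RV P >-> SU}) := distribution P X \x distribution P U.

HB.instance Definition _ {d1 d2} {SX : measurableType d1} {SU : measurableType d2}
  (X : {RV P >-> SX}) (U : {RV P >-> SU}) :=
  Probability.copy (indep_law X U) (distribution P X \x distribution P U).

(* [I(X; U) <= b], in a form that also asserts existence of the density and
   integrability of the information density [ln rho]. *)
Definition info_le {d1 d2} {SX : measurableType d1} {SU : measurableType d2}
    (X : {RV P >-> SX}) (U : {RV P >-> SU}) (b : R) :=
  exists rho : SX * SU -> R,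
  [/\ has_density (distribution P (pairRV X U)) (indep_law X U) rho,
      P.-integrable setT (EFin \o (fun w => ln (rho (X w, U w)))) &
      \int[P]_w (ln (rho (X w, U w)))%:E <= b%:E].

Section indep_law.
Context {d1 d2 : measure_display} {SX : measurableType d1} {SU : measurableType d2}.
Variables (X : {RV P >-> SX}) (U : {RV P >-> SU}).

Lemma integral_indep_law (h : SX * SU -> \bar R) :
  measurable_fun setT h -> (forall z, 0 <= h z) ->
  \int[indep_law X U]_z h z =
  \int[P]_w \int[distribution P X]_x h (x, U w).
Proof.
move=> mh h0; rewrite fubini_tonelli2// ge0_integral_distribution//.
  exact: measurable_fun_fubini_tonelli_G.
by move=> u; apply: integral_ge0.
Qed.

Lemma integral_indep_law_rect (r : SX * SU -> R) A B :
  measurable_fun setT r -> (forall z, (0 <= r z)%R) ->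
  measurable A -> measurable B ->
  \int[indep_law X U]_(z in A `*` B) (r z)%:E =
  \int[P]_(w in U @^-1` B) \int[distribution P X]_(x in A) (r (x, U w))%:E.
Proof.
move=> mr r0 mA mB; have mrE : measurable_fun setT (EFin \o r) by exact/measurable_EFinP.
rewrite integral_mkcond integral_indep_law; first last.
- by move=> z; apply: erestrict_ge0 => t _; rewrite lee_fin.
- apply/(measurable_restrictT _ (measurableX mA mB)); exact: measurable_funTS.
rewrite [RHS]integral_mkcond; apply: eq_integral => w _.
rewrite [RHS]patchE; case: ifPn => wB.
  rewrite [RHS]integral_mkcond; apply: eq_integral => x _.
  rewrite !patchE; congr (if _ then _ else _).
  by (apply/idP/idP; rewrite !inE) => [[]//|xA]; split => //; move: wB; rewrite inE.
rewrite integral0_eq// => x _; rewrite patchE ifF//.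
apply/negP; rewrite inE => -[_ /= wB'].
by move: wB; rewrite notin_setE.
Qed.

End indep_law.

(** [U] is psi(V), and every event of [V] is one of [U] because the sigma-algebra of [SV] is pulled
    back along [psi]; so [rho] composed with [psi] remains the density. This trades the pair (newest
    state, past) for a single history. *)
Lemma info_le_recode {d1 d2 d3} {SX : measurableType d1} {SU : measurableType d2}
  {SV : measurableType d3} (X : {RV P >-> SX}) (U : {RV P >-> SU})
  (V : {RV P >-> SV}) (psi : SV -> SU) (b : R) :
  measurable_fun setT psi -> (forall w, psi (V w) = U w) ->
  (forall C', measurable C' -> exists2 C, measurable C & C' = psi @^-1` C) ->
  info_le X U b -> info_le X V b.
Proof.
move=> mpsi psiV gen [rho [[mrho rho0 rhoE] irho int_le]].
pose rho' (z : SX * SV) := rho (z.1, psi z.2).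
exists rho'; split; last 2 first.
- by apply: eq_integrable irho => // w _; rewrite /= /rho' /= psiV.
- by under eq_integral do rewrite /rho' /= psiV.
have mrho' : measurable_fun setT rho'.
  apply: measurableT_comp => //; apply/measurable_fun_pair => //=.
  by apply: measurableT_comp => //; exact: measurable_snd.
have rho'0 z : (0 <= rho' z)%R by exact: rho0.
split => // D mD.
suff : distribution P (pairRV X V) D = density_measure (indep_law X V) mrho' rho'0 D by [].
move: D mD; apply: measure_eq_rect => [|A C' mA mC'].
  by rewrite -ge0_fin_numE ?fin_num_measure.
rewrite /= /density_measure integral_indep_law_rect//.
have [C mC ->] := gen _ mC'.
have := rhoE (A `*` C) (measurableX mA mC); rewrite integral_indep_law_rect//.
rewrite /distribution /pushforward /= => PE.
transitivity (P (pairRV X U @^-1` (A `*` C))).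
  congr (P _); apply/seteqP; split => w /= [? ?]; split => //=.
    by rewrite -psiV.
  by rewrite psiV.
rewrite PE.
have -> : V @^-1` (psi @^-1` C) = U @^-1` C.
  by apply/seteqP; split => w /=; rewrite psiV.
by apply: eq_integral => w _; rewrite /rho' /= psiV.
Qed.

Lemma ae_distribution {d1} {SU : measurableType d1} (U : {RV P >-> SU})
  (A : SU -> Prop) :
  {ae distribution P U, forall u, A u} -> {ae P, forall w, A (U w)}.
Proof.
move=> [N [mN N0 AN]]; exists (U @^-1` N); split => //; last by move=> w /AN.
exact: measurable_funPTI.
Qed.

Lemma measurable_condexp {d1} {SU : measurableType d1} (U : {RV P >-> SU})
  (f : Omega -> R) : measurable_fun setT (condexp U f).
Proof. by rewrite /condexp; case: xgetP => [g _ []//|_]; exact: measurable_cst. Qed.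

Section conditional_step.
Context {d1 d2 d3 : measure_display} {SX : measurableType d1}
  {SY : measurableType d2} {SZ : measurableType d3}.
Variables (X : {RV P >-> SX}) (Y : {RV P >-> SY}) (Z : {RV P >-> SZ}).

(** Given Z = z, [X] has density rho(., z) with respect to its own law, and under [Q] conditioning
    on [Y] as well changes nothing. The identity is checked on rectangles. *)
Lemma cond_indep_density (rho : SX * SZ -> R)
    (Q : probability (SX * (SY * SZ))%type R) :
  has_density (distribution P (pairRV X Z)) (indep_law X Z) rho ->
  cond_indep_law X Y Z Q ->
  has_density Q (indep_law X (pairRV Y Z)) (fun v => rho (v.1, v.2.2)).
Proof.
move=> [mrho rho0 rhoE] QE.
set rho' := fun _ => _.
have mrho' : measurable_fun setT rho'.
  apply: measurableT_comp => //; apply/measurable_fun_pair => //=.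
  by apply: measurableT_comp => //; exact: measurable_snd.
have rho'0 z : (0 <= rho' z)%R by exact: rho0.
split => // D mD.
suff : Q D = density_measure (indep_law X (pairRV Y Z)) mrho' rho'0 D by [].
move: D mD; apply: measure_eq_rect3 => A B C mA mB mC.
have mXA : measurable (X @^-1` A) by exact: measurable_funPTI.
have mYB : measurable (Y @^-1` B) by exact: measurable_funPTI.
have mZC : measurable (Z @^-1` C) by exact: measurable_funPTI.
have [a [ma a0 _ aE]] := cond_prob_density Z mXA.
have [b [mb b0 bint bE]] := cond_prob_density Z mYB.
(* [alpha z] is P(X in A | Z = z) computed from [rho]; [a] is the same quantity as a Radon-Nikodym
   derivative, and [b] is P(Y in B | Z = z). *)
pose alpha z := \int[distribution P X]_(x in A) (rho (x, z))%:E.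
have alpha0 z : 0 <= alpha z by apply: integral_ge0 => x _; rewrite lee_fin.
have malpha : measurable_fun setT alpha.
  rewrite (_ : alpha = fubini_G (distribution P X) ((EFin \o rho) \_ (A `*` setT))).
    apply: measurable_fun_fubini_tonelli_G.
      apply/(measurable_restrictT _ (measurableX mA measurableT)).
      exact/measurable_funTS/measurable_EFinP.
    by move=> z; apply: erestrict_ge0 => t _; rewrite lee_fin.
  apply/funext => z; rewrite /alpha /fubini_G [LHS]integral_mkcond.
  apply: eq_integral => x _; rewrite !patchE; congr (if _ then _ else _).
  by apply/idP/idP; rewrite !inE => // -[].
have pushE (h : SZ -> \bar R) E : measurable E -> measurable_fun setT h ->
    (forall z, 0 <= h z) ->
    \int[P]_(w in Z @^-1` E) h (Z w) = \int[distribution P Z]_(z in E) h z.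
  move=> mE mh h0; rewrite ge0_integral_pushforward//; first exact: measurable_funTS.
have maE : measurable_fun setT (EFin \o a) by exact/measurable_EFinP.
have mbE : measurable_fun setT (EFin \o b) by exact/measurable_EFinP.
have a_alpha : ae_eq (distribution P Z) setT (EFin \o a) alpha.
  apply: integral_ae_eq => //.
    apply/integrableP; split => //.
    under eq_integral do rewrite /= ger0_norm//.
    rewrite -aE// (le_lt_trans (probability_le1 P _))// ?ltry//.
    by rewrite preimage_setT setIT.
  move=> E _ mE; rewrite -aE// -pushE//.
  rewrite -(integral_indep_law_rect X Z mrho rho0 mA mE) -rhoE//.
  exact: measurableX.
rewrite /= QE// /density_measure integral_indep_law_rect//; last exact: measurableX.
transitivity (\int[P]_(w in Z @^-1` C) (a (Z w) * b (Z w))%:E).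
  apply: ae_eq_integral => //.
  - apply/measurable_funTS/measurable_EFinP/measurable_funM.
      by apply: measurableT_comp => //; exact: measurable_condexp.
    by apply: measurableT_comp => //; exact: measurable_condexp.
  - apply/measurable_funTS/measurable_EFinP/measurable_funM.
      exact: measurableT_comp.
    exact: measurableT_comp.
  - have := ae_distribution (condexp_indic mXA ma a0 aE).
    have := ae_distribution (condexp_indic mYB mb b0 bE).
    apply: filterS2 => w /(_ I) [hb] /(_ I) [ha] _.
    by rewrite -ha -hb.
rewrite (pushE (fun z => (a z * b z)%:E))//; first last.
- by move=> z; rewrite lee_fin mulr_ge0.
- by apply/measurable_EFinP; exact: measurable_funM.
transitivity (\int[distribution P Z]_(z in C) (alpha z * (b z)%:E)).
  apply: ae_eq_integral => //.
  - by apply/measurable_funTS/measurable_EFinP; exact: measurable_funM.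
  - by apply/measurable_funTS; exact: emeasurable_funM.
  - apply: filterS a_alpha => z /(_ I) /= <- _; by rewrite EFinM.
transitivity (\int[distribution P Z]_z ((alpha \_ C) z * (b z)%:E)).
  rewrite integral_mkcond; apply: eq_integral => z _.
  by rewrite !patchE; case: ifPn => //; rewrite mul0e.
(* Weighting by [b] under the law of [Z] amounts to restricting [P] to the event Y in B. *)
rewrite -bint; first last.
- by move=> z; exact: erestrict_ge0.
- by apply/(measurable_restrictT _ mC); exact: measurable_funTS.
rewrite (_ : pairRV Y Z @^-1` (B `*` C) = Y @^-1` B `&` Z @^-1` C); last first.
  by apply/seteqP; split => w [].
rewrite integral_mkcondr; apply: eq_integral => w _.
by rewrite !patchE.
Qed.

End conditional_step.

End information_bound.

Lemma ae_eq_integrable {d : measure_display} {T : measurableType d} {R : realType}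
  (mu : {measure set T -> \bar R}) (f g : T -> \bar R) :
  measurable_fun setT f -> ae_eq mu setT f g ->
  mu.-integrable setT g -> mu.-integrable setT f.
Proof.
move=> mf fg /integrableP[mg g_lt]; apply/integrableP; split => //.
rewrite (_ : \int[mu]_x `|f x| = \int[mu]_x `|g x|)%E//.
apply: ae_eq_integral => //; [exact: measurableT_comp|exact: measurableT_comp|].
by apply: filterS fg => x /(_ I) -> _.
Qed.

Section chain_step.
Context {d : measure_display} {Omega : measurableType d} {R : realType}.
Variable P : probability Omega R.
Context {d1 d2 d3 : measure_display} {SX : measurableType d1}
  {SY : measurableType d2} {SZ : measurableType d3}.
Variables (X : {RV P >-> SX}) (Y : {RV P >-> SY}) (Z : {RV P >-> SZ}).
Local Open Scope ereal_scope.

(** Chain rule on densities: the joint law has density [r] with respect to [Q], and [Q] has density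
    rho(x, z) with respect to the product law. The density for the pair is their product, and its
    logarithm a sum. *)
Lemma info_le_step (b c e : R) : (0 < e)%R -> info_le X Z b ->
  cond_mutual_info X Y Z <= c%:E -> info_le X (pairRV Y Z) (b + (c + e))%R.
Proof.
move=> e0 [rho [drho irho rho_le]] cmi.
have [_ [Q QE <-] klQ] : exists2 x, [set kl (distribution P (pairRV X (pairRV Y Z))) Q
            | Q in cond_indep_law X Y Z] x & x < (c + e)%:E.
  (* The slack [e] turns a bound on the infimum into an actual law [Q] with divergence below c +
     e. *)
  apply: ereal_inf_lt; apply: (le_lt_trans cmi).
  by rewrite lte_fin ltrDl.
have [r [dr ir r_lt]] := kl_density klQ.
have dQ := cond_indep_density drho QE.
have [mrho rho0 rhoE] := drho; have [mr r0 rE] := dr.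
have [mrho' rho'0 rho'E] := dQ.
set rho' := fun v => _ in mrho' rho'0 rho'E.
set W := pairRV X (pairRV Y Z).
have dprod : has_density (distribution P W) (indep_law X (pairRV Y Z)) (rho' \* r)%R.
  split; first exact: measurable_funM.
    by move=> v; rewrite mulr_ge0// rho'0.
  move=> D mD; rewrite rE//; pose h := (EFin \o r) \_ D.
  have mh : measurable_fun setT h.
    by apply/(measurable_restrictT _ mD)/measurable_funTS/measurable_EFinP.
  have h0 v : 0 <= h v by apply: erestrict_ge0 => t _; rewrite lee_fin.
  transitivity (\int[Q]_v h v); first by rewrite integral_mkcond.
  rewrite (ge0_integral_density dQ mh h0) [RHS]integral_mkcond.
  apply: eq_integral => v _; rewrite /h !patchE; case: ifPn => _; last by rewrite mul0e.
  by rewrite -EFinM mulrC.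
have mlnr : measurable_fun setT (EFin \o (fun v => ln (r v))).
  exact: measurable_int ir.
have irW : P.-integrable setT (EFin \o (fun w => ln (r (W w)))).
  have [_ lnr_lty] := integrableP _ _ _ ir; apply/integrableP; split.
    by apply: (measurableT_comp mlnr); exact: measurable_pairRV.
  move: lnr_lty; rewrite ge0_integral_distribution//.
  exact: measurableT_comp.
have rW_le : \int[P]_w (ln (r (W w)))%:E <= (c + e)%:E.
  by apply/ltW; move: r_lt; rewrite integral_distribution.
have lnE : ae_eq P setT (EFin \o (fun w => ln ((rho' \* r)%R (W w))))
   (fun w => (ln (rho (X w, Z w)))%:E + (ln (r (W w)))%:E).
  have := ae_distribution (has_density_ae_gt0 drho).
  have := ae_distribution (has_density_ae_gt0 dr).
  apply: filterS2 => w rW rhoW _; rewrite /= lnM ?posrE//.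
have mlnE : measurable_fun setT (EFin \o (fun w => ln ((rho' \* r)%R (W w)))).
  have [mrr _ _] := dprod; apply/measurable_EFinP.
  apply: measurableT_comp => //; apply: (measurableT_comp mrr).
  exact: measurable_pairRV.
have isum := integrableD measurableT irho irW.
exists (rho' \* r)%R; split => //.
- exact: ae_eq_integrable lnE isum.
- rewrite (ae_eq_integral _ _ measurableT mlnE (measurable_int _ isum) lnE).
  by rewrite integralD// EFinD leeD.
Qed.

End chain_step.

(** * Histories of states as finite products, and the chain rule *)

Lemma measurable_to_prod_space {I : Type} {dM dV : measure_display}
  (S : I -> measurableType dM) {SV : measurableType dV}
  (f : SV -> prod_space S) :
  (forall i, measurable_fun setT (fun v => f v i)) -> measurable_fun setT f.
Proof.
move=> mf; apply: measurability => // _ [_ [i [B [mB ->]]] <-]; rewrite setTI.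
have := mf i measurableT _ mB; rewrite setTI; exact.
Qed.

Lemma measurable_coord {I : Type} {dM : measure_display}
  (S : I -> measurableType dM) (i : I) :
  measurable_fun setT (fun v : prod_space S => v i).
Proof.
move=> _ B mB; rewrite setTI; apply: sub_sigma_algebra; exists i, B; split => //.
Qed.

Section restriction.
Context {dM : measure_display} (S : nat -> measurableType dM) (t : nat).

Definition split_last (v : prod_space (fun s : 'I_t.+1 => S s)) :
  S t * prod_space (fun s : 'I_t => S s) :=
  (v ord_max, fun s : 'I_t => v (widen_ord (leqnSn t) s)).

Lemma measurable_split_last : measurable_fun setT split_last.
Proof.
apply/measurable_fun_pair => /=.
  exact: (@measurable_coord _ _ (fun s : 'I_t.+1 => S s) ord_max).
apply: measurable_to_prod_space => s.
exact: (@measurable_coord _ _ (fun s : 'I_t.+1 => S s) (widen_ord (leqnSn t) s)).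
Qed.

(** Preimages under [split_last] form a sigma-algebra; it contains the cylinders, since a coordinate
    is either the last one or belongs to the past. *)
Lemma split_last_generates C' : measurable C' ->
  exists2 C, measurable C & C' = split_last @^-1` C.
Proof.
move: C'; apply: smallest_sub; first split.
- by exists set0.
- move=> _ [C mC ->]; exists (~` C); first exact: measurableC.
  by rewrite setTD.
- move=> F mF; pose G n := sval (cid2 (mF n)).
  exists (\bigcup_n G n).
    by apply: bigcupT_measurable => n; rewrite /G; case: cid2.
  rewrite preimage_bigcup; apply: eq_bigcupr => n _.
  by rewrite /G; case: cid2.
- move=> _ [[s hs] [B [mB ->]]] /=.
  have := hs; rewrite ltnS leq_eqVlt => /orP[/eqP st|st].
    subst s; have ? : hs = ltnSn t by exact: bool_irrelevance.
    subst hs; exists (B `*` setT); first exact: measurableX.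
    by apply/seteqP; split => v /= => [|[]].
  have ? : hs = widen_ord_proof (Ordinal st) (leqnSn t) by exact: bool_irrelevance.
  subst hs.
  exists (setT `*` [set z : prod_space (fun s : 'I_t => S s) | B (z (Ordinal st))]).
    apply: measurableX => //; rewrite -[X in measurable X]setTI.
    exact: (@measurable_coord _ _ (fun s : 'I_t => S s) (Ordinal st)).
  by apply/seteqP; split => v /= => [|[]].
Qed.

End restriction.

Section chain_rule.
Context {d : measure_display} {Omega : measurableType d} {R : realType}.
Variable P : probability Omega R.
Context {dX : measure_display} {SX : measurableType dX} (X : {RV P >-> SX}).
Context {dM : measure_display} (S : nat -> measurableType dM)
  (M : forall t, {RV P >-> S t}).
Local Open Scope ereal_scope.

(** A family indexed by the empty type takes its values in a one-point space, so it is independent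
    of [X] and the density is 1. *)
Lemma info_le0 : info_le X (joint (fun s : 'I_0 => M s) : {RV P >-> _}) 0.
Proof.
set U := (joint _ : {RV P >-> _}).
exists (cst 1%R); split; last 2 first.
- rewrite (_ : _ \o _ = EFin \o cst (ln 1%R))//.
  exact: finite_measure_integrable_cst.
- by under eq_integral do rewrite /= ln1; rewrite integral0.
split => // D mD; rewrite [RHS](integral_cst _ mD 1) mul1e; move: D mD.
apply: measure_eq_rect => [|A B mA mB].
  by rewrite -ge0_fin_numE ?fin_num_measure.
transitivity (distribution P X A * distribution P U B); last first.
  exact/esym/product_measure1E.
have all_eq (f g : prod_space (fun s : 'I_0 => S s)) : f = g.
  by apply: functional_extensionality_dep => -[].
have [->|/set0P[f Bf]] := eqVneq B set0.
  by rewrite setX0 !measure0 mule0.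
have -> : B = setT by apply/seteqP; split => // g _; rewrite (all_eq g f).
rewrite -[X in _ * X]/(distribution P U setT) probability_setT mule1.
by rewrite /distribution /pushforward; congr (P _); apply/seteqP; split => w // [].
Qed.

Lemma info_le_chain (c e : R) (T : nat) : (0 < e)%R ->
  (forall t, (t < T)%N ->
     cond_mutual_info X (M t) (joint (fun s : 'I_t => M s) : {RV P >-> _}) <= c%:E) ->
  info_le X (joint (fun s : 'I_T => M s) : {RV P >-> _}) (T%:R * (c + e))%R.
Proof.
move=> e0; elim: T => [_|T IH cmi]; first by rewrite mul0r; exact: info_le0.
have /info_le_step - /(_ _ _ _ _ _ e0 (cmi _ (ltnSn T))) : info_le X
    (joint (fun s : 'I_T => M s) : {RV P >-> _}) (T%:R * (c + e))%R.
  by apply: IH => t tT; apply: cmi; exact: ltnW.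
rewrite -natr1 mulrDl mul1r; apply: info_le_recode.
- exact: measurable_split_last.
- by move=> w.
- exact: split_last_generates.
Qed.

End chain_rule.

(** * Gaussian integrals *)

Section standard_normal.
Context {R : realType}.
Local Open Scope ereal_scope.

Lemma normal_prob_density (m s : R) :
  has_density (normal_prob m s) lebesgue_measure (normal_pdf m s).
Proof.
by split => //; [exact: measurable_normal_pdf|exact: normal_pdf_ge0].
Qed.

(** The integrand times the standard normal density is 1 / c times the density of N(-b / c, 1 /
    c^2). The value is free of [b], which later allows an arbitrary conditional mean. *)
Lemma normal_prob_gauss (c b : R) : (0 < c)%R ->
  \int[normal_prob 0 1]_x (expR (x ^+ 2 / 2 - (c * x + b) ^+ 2 / 2))%:E =
  (c^-1)%:E.
Proof.
move=> c0; have c1 : c != 0%R by rewrite gt_eqF.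
have meas : measurable_fun setT (fun x : R => expR (x ^+ 2 / 2 - (c * x + b) ^+ 2 / 2)).
  apply: measurableT_comp => //; apply: measurable_funB.
    by apply: measurable_funM => //; exact: measurable_funX.
  apply: measurable_funM => //; apply: measurable_funX.
  by apply: measurable_funD => //; exact: measurable_funM.
rewrite (ge0_integral_density (normal_prob_density 0 1)); first last.
- by move=> x; rewrite lee_fin expR_ge0.
- exact/measurable_EFinP.
transitivity (\int[lebesgue_measure]_x
  ((c^-1)%:E * (normal_pdf (- b / c) c^-1 x)%:E)).
  apply: eq_integral => x _; rewrite -!EFinM; congr (_%:E).
  rewrite !normal_pdfE ?invr_eq0 ?oner_eq0// /normal_peak /normal_fun.
  rewrite expr1n !mul1r subr0 exprVn.
  rewrite (_ : (c ^+ 2)^-1 * pi *+ 2 = (c^-1) ^+ 2 * (pi *+ 2))%R; last first.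
    by rewrite exprVn -(mulr_natr pi) -mulr_natr mulrA.
  rewrite sqrtrM ?sqr_ge0// sqrtr_sqr ger0_norm ?invr_ge0 ?ltW//.
  rewrite invfM invrK !mulrA mulVf// mul1r mulrAC [RHS]mulrC; congr (_ * _)%R.
  rewrite -expRD; congr expR.
  by field.
rewrite ge0_integralZl//.
- by rewrite integral_normal_pdf mule1.
- by apply/measurable_EFinP; exact: measurable_normal_pdf.
- by move=> x _; rewrite lee_fin normal_pdf_ge0.
- by rewrite lee_fin invr_ge0 ltW.
Qed.

(** Both claims follow from E exp((1 - c^2) x^2 / 2) = 1 / c and 1 + t <= exp t: c = 1/2 gives
    integrability, and c > 1 gives E x^2 >= 2 / (c (c + 1)), which tends to 1 as c decreases to
    1. *)
Lemma normal_prob_sqr :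
  (normal_prob 0 1).-integrable setT (fun x : R => (x ^+ 2)%:E) /\
  1 <= \int[normal_prob (0 : R) 1]_x (x ^+ 2)%:E.
Proof.
have mx2 : measurable_fun setT (fun x : R => x ^+ 2)%R by exact: measurable_funX.
have mx2E := (measurable_EFinP _ _).2 mx2.
have gauss (c : R) : (0 < c)%R ->
  \int[normal_prob 0 1]_x (expR ((1 - c ^+ 2) / 2 * x ^+ 2))%:E = (c^-1)%:E.
  move=> c0; rewrite -(normal_prob_gauss 0 c0); apply: eq_integral => x _.
  by congr ((expR _)%:E); field.
have i2 : (normal_prob 0 1).-integrable setT (fun x : R => (x ^+ 2)%:E).
  apply/integrableP; split => //.
  have c0 : (0 < 2^-1 :> R)%R by lra.
  (* At c = 1/2 the exponent is 3 x^2 / 8, and y <= exp y gives x^2 <= (8 / 3) exp(3 x^2 / 8). *)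
  apply: (@le_lt_trans _ _ (\int[normal_prob (0 : R) 1]_x
    ((8 / 3)%:E * (expR ((1 - 2^-1 ^+ 2) / 2 * x ^+ 2))%:E))).
    apply: ge0_le_integral => //.
    - exact: measurableT_comp.
    - apply/measurable_EFinP; apply: measurable_funM => //.
      by apply: measurableT_comp => //; exact: measurable_funM.
    - move=> x _; rewrite -EFinM lee_fin ger0_norm ?sqr_ge0//.
      have := expR_ge1Dx ((1 - 2^-1 ^+ 2) / 2 * x ^+ 2); have := sqr_ge0 x; lra.
  rewrite ge0_integralZl//; first by rewrite gauss// -EFinM ltry.
  - apply/measurable_EFinP; apply: measurableT_comp => //.
    exact: measurable_funM.
split => //; set m := \int[_]_x _.
have mfin : m = (fine m)%:E by rewrite fineK// integrable_fin_num.
have lb (c : R) : (1 < c)%R -> (2 / (c * (c + 1)) <= fine m)%R.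
  move=> c1; have c0 : (0 < c)%R by lra.
  have : \int[normal_prob (0 : R) 1]_x (cst 1 x + ((1 - c ^+ 2) / 2)%:E * (x ^+ 2)%:E)
      <= \int[normal_prob (0 : R) 1]_x (expR ((1 - c ^+ 2) / 2 * x ^+ 2))%:E.
    apply: le_integral => //.
    - apply: integrableD => //; first exact: finite_measure_integrable_cst.
      exact: integrableZl.
    - apply/integrableP; split.
        apply/measurable_EFinP; apply: measurableT_comp => //.
        exact: measurable_funM.
      under eq_integral do rewrite /= ger0_norm ?expR_ge0//.
      by rewrite gauss// ltry.
    - move=> x _; rewrite /= -EFinM -EFinD lee_fin; exact: expR_ge1Dx.
  rewrite gauss// integralD//; last 2 first.
  - exact: finite_measure_integrable_cst.
  - exact: integrableZl.
  rewrite integral_cst//= probability_setT mul1e integralZl// -/m mfin.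
  rewrite -EFinM -EFinD lee_fin => h.
  have {}h : (c + (1 - c ^+ 2) / 2 * fine m * c <= 1)%R.
    by rewrite -(ler_pM2r c0) mulrDl mul1r mulVf ?gt_eqF// in h.
  rewrite ler_pdivrMr; last by rewrite mulr_gt0//; lra.
  have {}h : ((c - 1) * 2 <= (c - 1) * (fine m * (c * (c + 1))))%R by lra.
  by rewrite ler_pM2l ?subr_gt0 in h.
rewrite mfin lee_fin leNgt; apply/negP => m1.
have m0 : (0 <= fine m)%R.
  by rewrite fine_ge0// integral_ge0// => x _; rewrite lee_fin sqr_ge0.
(* With m = 1 - 4 e, the bound at c = 1 + e would read 2 <= (1 - 4 e) (1 + e) (2 + e), which fails
   for e > 0. *)
pose e := ((1 - fine m) / 4)%R.
have e0 : (0 < e)%R by rewrite /e; lra.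
have := lb (1 + e)%R; rewrite ltrDl => /(_ e0).
rewrite ler_pdivrMr; last by rewrite mulr_gt0//; lra.
have -> : fine m = (1 - 4 * e)%R by rewrite /e; lra.
have : (4 * e <= 1)%R by rewrite /e; lra.
nra.
Qed.

(* [normal_prob 0 1] lives on [measurableTypeR R]; [std_normal] is the same
   measure on [R]. *)
Definition idTR : measurableTypeR R -> R := idfun.

Lemma measurable_idTR : measurable_fun setT idTR.
Proof. exact: (@measurable_id _ (measurableTypeR R)). Qed.

HB.instance Definition _ := isMeasurableFun.Build _ _ _ _ idTR measurable_idTR.

Definition std_normal : probability R R := distribution (normal_prob (0 : R) 1) idTR.

Lemma ge0_integral_std_normal (F : R -> \bar R) :
  measurable_fun setT F -> (forall x, 0 <= F x) ->
  \int[std_normal]_x F x = \int[normal_prob (0 : R) 1]_x F x.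
Proof. by move=> mF F0; rewrite ge0_integral_distribution. Qed.

Lemma std_normal_sqr : std_normal.-integrable setT (fun x : R => (x ^+ 2)%:E) /\
  1 <= \int[std_normal]_x (x ^+ 2)%:E.
Proof.
have [i2 ge1] := normal_prob_sqr.
have mx2 : measurable_fun setT (fun x : R => (x ^+ 2)%:E).
  by apply/measurable_EFinP; exact: measurable_funX.
split; last by rewrite ge0_integral_std_normal// => x; rewrite lee_fin sqr_ge0.
apply/integrableP; split => //; rewrite ge0_integral_std_normal//.
  by case/integrableP : i2.
exact: measurableT_comp.
Qed.

Lemma std_normal_gauss (c b : R) : (0 < c)%R ->
  \int[std_normal]_x (expR (x ^+ 2 / 2 - (c * x + b) ^+ 2 / 2))%:E = (c^-1)%:E.
Proof.
move=> c0; rewrite ge0_integral_std_normal ?normal_prob_gauss//.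
apply/measurable_EFinP; apply: measurableT_comp => //; apply: measurable_funB.
  by apply: measurable_funM => //; exact: measurable_funX.
apply: measurable_funM => //; apply: measurable_funX.
by apply: measurable_funD => //; exact: measurable_funM.
Qed.

End standard_normal.

Arguments std_normal : clear implicits.

(** * Integration of standard normal vectors, one coordinate at a time *)

Section gaussian_vectors.
Context {d : measure_display} {Omega : measurableType d} {R : realType}.
Variables (P : probability Omega R) (k : nat).
Local Open Scope ereal_scope.

Local Notation RV := (prod_space (fun _ : 'I_k => R)).

Definition box (B : 'I_k -> set R) : set RV := [set z | forall i, B i (z i)].

Definition upd (z : RV) (i : 'I_k) (x : R) : RV := fun j => if j == i then x else z j.

Lemma measurable_box B : (forall i, measurable (B i)) -> measurable (box B).
Proof.
move=> mB; rewrite (_ : box B = \bigcap_(i in [set: 'I_k]) [set z | B i (z i)]).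
  apply: fin_bigcap_measurable => // i _; rewrite -[X in measurable X]setTI.
  exact: (@measurable_coord _ _ (fun _ : 'I_k => R) i).
by apply/seteqP; split => z /= zB i *; exact: zB.
Qed.

Lemma measure_eq_box (m1 m2 : {measure set RV -> \bar R}) :
  m1 setT < +oo ->
  (forall B, (forall i, measurable (B i)) -> m1 (box B) = m2 (box B)) ->
  forall D, measurable D -> m1 D = m2 D.
Proof.
move=> m1oo m12 D mD.
pose G : set (set RV) := [set D | exists2 B, forall i, measurable (B i) & D = box B].
apply: (measure_unique G (fun=> setT)) => //.
- apply/seteqP; split; apply: smallest_sub.
  + exact: smallest_sigma_algebra.
  + move=> _ [i [B [mB ->]]]; apply: sub_sigma_algebra.
    exists (fun j => if j == i then B else setT) => [j|]; first by case: ifP.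
    apply/seteqP; split => z /= zB; last by have := zB i; rewrite eqxx.
    by move=> j; case: eqP => [->|].
  + exact: sigma_algebra_measurable.
  + by move=> _ [B mB ->]; exact: measurable_box.
- move=> _ _ [A mA ->] [B mB ->]; exists (fun i => A i `&` B i).
    by move=> i; exact: measurableI.
  apply/seteqP; split => z /=; first by move=> [zA zB] i; split.
  by move=> zAB; split => i; have [] := zAB i.
- by move=> _; exists (fun=> setT) => //; apply/seteqP; split.
- by apply/seteqP; split => // x _; exists 0%N.
- by move=> _ [B mB ->]; exact: m12.
Qed.

Variables (Z : 'I_k -> {RV P >-> R}) (hZ : iid_std_normal Z).

Lemma prob_box B : (forall i, measurable (B i)) ->
  distribution P (joint Z) (box B) = \prod_(i < k) std_normal R (B i).
Proof.
move=> mB; rewrite -hZ//; congr (P _).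
by apply/seteqP; split => w /= wB i *; exact: wB.
Qed.

Lemma measurable_upd i : measurable_fun setT (fun u : R * RV => upd u.2 i u.1).
Proof.
apply: measurable_to_prod_space => j; rewrite /upd; case: eqP => _.
  exact: measurable_fst.
apply: (measurableT_comp (@measurable_coord _ _ (fun _ : 'I_k => R) j)).
exact: measurable_snd.
Qed.

(** Fubini for the law of [Z], without writing it as a product measure on R^k: overwriting
    coordinate [i] by an independent standard normal keeps the law, since both laws agree on
    boxes. *)
Lemma normal_resample (F : RV -> \bar R) (i : 'I_k) :
  measurable_fun setT F -> (forall z, 0 <= F z) ->
  \int[P]_w F (joint Z w) =
  \int[P]_w \int[std_normal R]_x F (upd (joint Z w) i x).
Proof.
move=> mF F0; have mupd := measurable_upd i.
have mFu : measurable_fun setT (fun u : R * RV => F (upd u.2 i u.1)).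
  exact: (measurableT_comp mF mupd).
pose nu := std_normal R \x distribution P (joint Z).
pose updm : {mfun (R * RV)%type >-> RV} :=
  HB.pack (fun u : R * RV => upd u.2 i u.1)%type (isMeasurableFun.Build _ _ _ _ _ mupd).
transitivity (\int[distribution P (joint Z)]_z F z).
  by rewrite ge0_integral_distribution.
transitivity (\int[distribution nu updm]_z F z).
  apply: eq_measure_integral => D mD _; move: D mD; apply: measure_eq_box.
    by rewrite -ge0_fin_numE ?fin_num_measure.
  move=> B mB; rewrite [LHS]prob_box// /distribution /pushforward /=.
  pose B' j := if j == i then setT else B j.
  have mB' j : measurable (B' j) by rewrite /B'; case: ifP.
  rewrite (_ : _ @^-1` _ = B i `*` box B'); last first.
    apply/seteqP; split => -[x z] /=.
      move=> zB; split; first by have := zB i; rewrite /upd eqxx.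
      by move=> j; have := zB j; rewrite /B' /upd /=; case: ifP.
    move=> [xB zB] j; have := zB j; rewrite /B' /upd /=.
    by case: eqP => // ->.
  transitivity (std_normal R (B i) * distribution P (joint Z) (box B')).
    rewrite prob_box// (bigD1 i)//= [in RHS](bigD1 i)//= /B' eqxx.
    rewrite probability_setT mul1e; congr (_ * _).
    by apply: eq_bigr => j /negbTE ->.
  by apply/esym; apply: product_measure1E => //; exact: measurable_box.
have F0' u : 0 <= F (upd u.2 i u.1) by exact: F0.
pose G (z : RV) := \int[std_normal R]_x F (upd z i x).
transitivity (\int[distribution P (joint Z)]_z G z).
  rewrite ge0_integral_distribution//.
  exact: (@fubini_tonelli2 _ _ _ _ _ (std_normal R) (distribution P (joint Z)) _ mFu F0').
rewrite ge0_integral_distribution//.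
  exact: (@measurable_fun_fubini_tonelli_G _ _ _ _ _ (std_normal R) _ mFu F0').
by move=> z; exact: integral_ge0.
Qed.

End gaussian_vectors.

Section gaussian_integrals.
Context {d : measure_display} {Omega : measurableType d} {R : realType}.
Variables (P : probability Omega R) (k : nat).
Variables (Z : 'I_k -> {RV P >-> R}) (hZ : iid_std_normal Z).
Local Open Scope ereal_scope.

Local Notation RV := (prod_space (fun _ : 'I_k => R)).

Lemma iid_normal_sqr (i : 'I_k) :
  P.-integrable setT (EFin \o (fun w => Z i w ^+ 2)%R) /\
  1 <= \int[P]_w (Z i w ^+ 2)%:E.
Proof.
have [i2 ge1] := std_normal_sqr (R := R).
have E : \int[P]_w (Z i w ^+ 2)%:E = \int[std_normal R]_x (x ^+ 2)%:E.
  rewrite (normal_resample hZ (F := fun z => (z i ^+ 2)%:E) i); first last.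
  - by move=> z; rewrite lee_fin sqr_ge0.
  - apply/measurable_EFinP; apply: measurable_funX.
    exact: (@measurable_coord _ _ (fun _ : 'I_k => R) i).
  rewrite (eq_integral (cst (\int[std_normal R]_x (x ^+ 2)%:E))); last first.
    by move=> w _; apply: eq_integral => x _; rewrite /upd eqxx.
  by rewrite integral_cst//= probability_setT mule1.
split; last by rewrite E.
apply/integrableP; split.
  by apply/measurable_EFinP; apply: measurable_funX.
under eq_integral do rewrite /= ger0_norm ?sqr_ge0//.
rewrite E; exact: integrable_lty.
Qed.

Variables (C : 'M[R]_k) (b : 'I_k -> R).
Hypotheses (Ctri : forall i j : 'I_k, (j < i)%N -> C i j = 0%R)
  (Cpos : forall i, (0 < C i i)%R).

Let g (i : 'I_k) (z : RV) : R :=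
  expR (z i ^+ 2 / 2 - (\sum_j C i j * z j + b i) ^+ 2 / 2).

Let mg i : measurable_fun setT (g i).
Proof.
have mz j : measurable_fun setT (fun z : RV => z j).
  exact: (@measurable_coord _ _ (fun _ : 'I_k => R) j).
apply: measurableT_comp => //; apply: measurable_funB.
  by apply: measurable_funM => //; exact: measurable_funX.
apply: measurable_funM => //; apply: measurable_funX; apply: measurable_funD => //.
by apply: measurable_sum => j; exact: measurable_funM.
Qed.

(** Row i of [C] involves only coordinates j >= i, so among the rows from i on, coordinate i occurs
    in row i alone. Integrating the coordinates in increasing order removes one factor at a time. *)
Lemma gauss_triangular :
  \int[P]_w (\prod_i g i (joint Z w))%:E = (\prod_i (C i i)^-1)%:E.
Proof.
have g0 i z : (0 <= g i z)%R by exact: expR_ge0.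
(* The claim concerns the last [m] rows; the induction step adds the row above them and integrates
   its diagonal coordinate first. *)
suff claim m : (m <= k)%N ->
    \int[P]_w (\prod_(i < k | (k - m <= i)%N) g i (joint Z w))%:E =
    (\prod_(i < k | (k - m <= i)%N) (C i i)^-1)%:E.
  by have := claim k (leqnn k); rewrite subnn.
elim: m => [_|m IH mk].
  rewrite subn0 big_pred0; last by move=> i; rewrite leqNgt ltn_ord.
  rewrite (eq_integral (cst 1)); last first.
    by move=> w _; rewrite big_pred0// => i; rewrite leqNgt ltn_ord.
  by rewrite integral_cst//= probability_setT mule1.
have nk : (k - m.+1 < k)%N by lia.
pose i0 := Ordinal nk.
have predE (i : 'I_k) : (k - m.+1 <= i)%N && (i != i0) = (k - m <= i)%N.
  by rewrite -val_eqE /=; lia.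
have i0P : (k - m.+1 <= i0)%N by [].
pose F (z : RV) := (\prod_(i < k | (k - m.+1 <= i)%N) g i z)%:E.
have mprod (Q : pred 'I_k) : measurable_fun setT (fun z => \prod_(i < k | Q i) g i z)%R.
  have -> : (fun z : RV => \prod_(i < k | Q i) g i z)%R =
      (fun z => \prod_(i < k) if Q i then g i z else 1)%R.
    by apply/funext => z; rewrite big_mkcond.
  apply: measurable_prod => i _.
  by case: (Q i); [exact: mg|exact: measurable_cst].
rewrite (normal_resample hZ (F := F) i0); first last.
- by move=> z; rewrite lee_fin prodr_ge0.
- exact/measurable_EFinP.
(* [B] gathers what the resampled coordinate leaves fixed in row [i0]; it is the shift of a scalar
   Gaussian integral. *)
pose B (z : RV) := (\sum_(j | j != i0) C i0 j * z j + b i0)%R.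
have FE z x : F (upd z i0 x) = (\prod_(i < k | (k - m <= i)%N) g i z)%:E *
    (expR (x ^+ 2 / 2 - (C i0 i0 * x + B z) ^+ 2 / 2))%:E.
  rewrite /F (bigD1 i0)//= EFinM muleC; congr (_%:E * _%:E).
    apply: eq_big => [i|i]; first exact: predE.
    move=> ii0; rewrite /g; congr expR; congr (_ ^+ 2 / 2 - _ ^+ 2 / 2)%R.
      by rewrite /upd ifN//; case/andP: ii0.
    congr (_ + _)%R; apply: eq_bigr => j _; rewrite /upd; case: eqP => [->|//].
    by rewrite Ctri ?mul0r//; move: ii0; rewrite predE /=; lia.
  rewrite /g; congr expR; congr (_ ^+ 2 / 2 - _ ^+ 2 / 2)%R; first by rewrite /upd eqxx.
  rewrite (bigD1 i0)//= {1}/upd eqxx -addrA; congr (_ + (_ + _))%R.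
  by apply: eq_bigr => j ji; rewrite /upd ifN.
transitivity (\int[P]_w ((\prod_(i < k | (k - m <= i)%N) g i (joint Z w))%:E *
    ((C i0 i0)^-1)%:E)).
  apply: eq_integral => w _; under eq_integral do rewrite FE.
  rewrite ge0_integralZl//.
  - by rewrite std_normal_gauss.
  - apply/measurable_EFinP; apply: measurableT_comp => //; apply: measurable_funB.
      by apply: measurable_funM => //; exact: measurable_funX.
    apply: measurable_funM => //; apply: measurable_funX.
    by apply: measurable_funD => //; exact: measurable_funM.
  - by rewrite lee_fin prodr_ge0.
rewrite ge0_integralZr//.
- rewrite IH ?(ltnW mk)// -EFinM; congr (_%:E).
  by rewrite [in RHS](bigD1 i0)//= mulrC; congr (_ * _)%R; apply: eq_bigl => i.
- by apply/measurable_EFinP; apply: (measurableT_comp (mprod _)).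
- by move=> w _; rewrite lee_fin prodr_ge0.
- by rewrite lee_fin invr_ge0 ltW.
Qed.

End gaussian_integrals.

(** * The rate-distortion bound *)

Section means.
Context {d : measure_display} {T : measurableType d} {R : realType}.
Variable P : probability T R.

(** Integrability and value are kept together, so that the expectation of a long linear combination
    is assembled term by term. *)
Definition has_mean (f : T -> R) (m : R) :=
  P.-integrable setT (EFin \o f) /\ (\int[P]_x (f x)%:E)%E = m%:E.

Lemma integrable_has_mean (f : T -> R) : P.-integrable setT (EFin \o f) ->
  has_mean f (fine (\int[P]_x (f x)%:E)%E).
Proof. by move=> fi; split => //; rewrite fineK// integrable_fin_num. Qed.

Lemma has_mean_cst (c : R) : has_mean (cst c) c.
Proof.
split; first exact: finite_measure_integrable_cst.
by rewrite [LHS](integral_cst _ measurableT c%:E) /= probability_setT mule1.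
Qed.

Lemma has_meanD (f g : T -> R) (a b : R) :
  has_mean f a -> has_mean g b -> has_mean (fun x => f x + g x) (a + b).
Proof.
move=> [fi fa] [gi gb]; split; first by have := integrableD measurableT fi gi.
under eq_integral do rewrite EFinD.
by rewrite integralD// fa gb.
Qed.

Lemma has_meanZ (f : T -> R) (a c : R) :
  has_mean f a -> has_mean (fun x => c * f x) (c * a).
Proof.
move=> [fi fa]; split; first by have := integrableZl measurableT c fi.
under eq_integral do rewrite EFinM.
by rewrite integralZl// fa.
Qed.

Lemma has_mean_sum (I : finType) (f : I -> T -> R) (a : I -> R) :
  (forall i, has_mean (f i) (a i)) ->
  has_mean (fun x => \sum_i f i x) (\sum_i a i).
Proof.
move=> fa; rewrite -!(big_enum) /=.
have -> : (fun x => \sum_i f i x) = (fun x => \sum_(i <- enum I) f i x).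
  by apply/funext => x; rewrite big_enum.
elim: (enum I) => [|i s IH].
  rewrite big_nil; have := has_mean_cst 0; congr has_mean.
  by apply/funext => x; rewrite big_nil.
rewrite big_cons; have := has_meanD (fa i) IH; congr has_mean.
by apply/funext => x; rewrite big_cons.
Qed.

Lemma ae_le_integral (f g : T -> R) :
  P.-integrable setT (EFin \o f) -> P.-integrable setT (EFin \o g) ->
  {ae P, forall x, f x <= g x} ->
  (\int[P]_x (f x)%:E <= \int[P]_x (g x)%:E)%E.
Proof.
move=> fi gi fg; have mf := (measurable_EFinP _ _).1 (measurable_int _ fi).
have mg := (measurable_EFinP _ _).1 (measurable_int _ gi).
have mm : measurable_fun setT (EFin \o (f \max g)).
  by apply/measurable_EFinP; exact: measurable_maxr.
have mE : ae_eq P setT (EFin \o (f \max g)) (EFin \o g).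
  by apply: filterS fg => x fgx _; rewrite /= max_r.
rewrite -(ae_eq_integral _ _ measurableT mm (measurable_int _ gi) mE).
apply: le_integral => //; first exact: ae_eq_integrable mE gi.
by move=> x _; rewrite lee_fin le_max lexx.
Qed.

Definition sqr_integrable (f : T -> R) :=
  measurable_fun setT f /\ P.-integrable setT (EFin \o (fun x => f x ^+ 2)).

Lemma sqr_integrableM (f g : T -> R) : sqr_integrable f -> sqr_integrable g ->
  P.-integrable setT (EFin \o (fun x => f x * g x)).
Proof.
move=> [mf fi] [mg gi]; have H := integrableD measurableT fi gi.
apply: (le_integrable measurableT _ _ H).
  by apply/measurable_EFinP; exact: measurable_funM.
move=> x _; rewrite /= lee_fin [leRHS]ger0_norm ?addr_ge0 ?sqr_ge0//.
rewrite ler_norml; have := sqr_ge0 (f x + g x); have := sqr_ge0 (f x - g x).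
by have := sqr_ge0 (f x); have := sqr_ge0 (g x); move=> *; apply/andP; split; nra.
Qed.

Lemma sqr_integrableD (f g : T -> R) : sqr_integrable f -> sqr_integrable g ->
  sqr_integrable (fun x => f x + g x).
Proof.
move=> f2 g2; have fgi := sqr_integrableM f2 g2; move: f2 g2 => [mf fi] [mg gi].
split; first exact: measurable_funD.
have := integrableD measurableT (integrableD measurableT fi gi)
  (integrableZl measurableT 2 fgi).
apply: eq_integrable => // x _.
by rewrite /= -EFinM -!EFinD; congr (_%:E); ring.
Qed.

Lemma sqr_integrableZ (f : T -> R) (c : R) : sqr_integrable f ->
  sqr_integrable (fun x => c * f x).
Proof.
move=> [mf fi]; split; first exact: measurable_funM.
have := integrableZl measurableT (c ^+ 2) fi; apply: eq_integrable => // x _.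
by rewrite /= -EFinM exprMn.
Qed.

Lemma sqr_integrable_sum (I : finType) (f : I -> T -> R) :
  (forall i, sqr_integrable (f i)) -> sqr_integrable (fun x => \sum_i f i x).
Proof.
move=> f2; have -> : (fun x => \sum_i f i x) = (fun x => \sum_(i <- enum I) f i x).
  by apply/funext => x; rewrite big_enum.
elim: (enum I) => [|i s IH].
  rewrite (_ : (fun _ => _) = cst 0); last by apply/funext => x; rewrite big_nil.
  split; first exact: measurable_cst.
  rewrite (_ : _ \o _ = EFin \o cst (0 ^+ 2))//.
  exact: finite_measure_integrable_cst.
rewrite (_ : (fun _ => _) = fun x => f i x + \sum_(j <- s) f j x).
  exact: sqr_integrableD.
by apply/funext => x; rewrite big_cons.
Qed.

End means.

Section donsker_varadhan.
Context {d : measure_display} {Omega : measurableType d} {R : realType}.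
Variable P : probability Omega R.
Context {d1 d2 : measure_display} {SX : measurableType d1} {SU : measurableType d2}.
Variables (X : {RV P >-> SX}) (U : {RV P >-> SU}).
Local Open Scope ereal_scope.

(* Integrate [f - ln rho <= exp f / rho - 1] under the joint law. *)
Lemma info_le_test (f : SX * SU -> R) (b m : R) :
  measurable_fun setT f -> info_le X U b ->
  \int[indep_law X U]_z (expR (f z))%:E <= 1 ->
  has_mean P (fun w => f (X w, U w)) m -> (m <= b)%R.
Proof.
move=> mf [rho [drho irho rho_le]] f1 [fi fm]; have [mrho rho0 rhoE] := drho.
(* The power -1 is a measurable inverse with value 0 at 0, so h rho <= exp f holds everywhere. *)
pose h z := (expR (f z) * rho z `^ (-1))%R.
have h0 z : (0 <= h z)%R by rewrite mulr_ge0 ?expR_ge0 ?powR_ge0.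
have mh : measurable_fun setT h.
  apply: measurable_funM; first exact: measurableT_comp.
  exact: measurableT_comp (measurable_powR (-1)%R) mrho.
have mhE : measurable_fun setT (EFin \o h) by exact/measurable_EFinP.
have h1 : \int[P]_w (h (X w, U w))%:E <= 1.
  have -> : \int[P]_w (h (X w, U w))%:E =
      \int[distribution P (pairRV X U)]_z (EFin \o h) z.
    by rewrite ge0_integral_distribution// => z; rewrite lee_fin.
  rewrite (ge0_integral_density drho)//.
  apply: le_trans f1; apply: ge0_le_integral => //.
  - by move=> z _; rewrite mule_ge0// lee_fin.
  - by apply: emeasurable_funM => //; exact/measurable_EFinP.
  - by apply/measurable_EFinP; exact: measurableT_comp.
  - move=> z _; rewrite /= -EFinM lee_fin /h powR_inv1//.
    have [->|rz] := eqVneq (rho z) 0%R; first by rewrite mulr0 expR_ge0.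
    by rewrite mulfVK.
have mhw : measurable_fun setT (fun w => (h (X w, U w))%:E).
  by apply/measurable_EFinP/(measurableT_comp mh); exact: measurable_pairRV.
have hi : P.-integrable setT (EFin \o (fun w => h (X w, U w))).
  apply/integrableP; split => //.
  under eq_integral do rewrite /= ger0_norm//.
  by rewrite (le_lt_trans h1)// ltry.
have [li lE] := integrable_has_mean irho.
have [hi' hE] := integrable_has_mean hi.
set l := fine _ in lE; set n := fine _ in hE.
have lb : (l <= b)%R by rewrite -lee_fin -lE.
have n1 : (n <= 1)%R by rewrite -lee_fin -hE.
have [sumi sumE] := has_meanD (has_meanD (has_mean_cst P (-1)%R)
  (integrable_has_mean hi)) (integrable_has_mean irho).
suff : (m <= - 1 + n + l)%R by move: lb n1; lra.
rewrite -lee_fin -fm -sumE; apply: ae_le_integral => //.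
have := ae_distribution (has_density_ae_gt0 drho); apply: filterS => w rw.
set z := (X w, U w); have {}rw : (0 < rho z)%R := rw.
have := expR_ge1Dx (f z - ln (rho z)).
rewrite expRB lnK ?posrE// /h powR_inv1; last exact: ltW.
rewrite /cst; lra.
Qed.

End donsker_varadhan.

Section gaussian_rate.
Context {d : measure_display} {Omega : measurableType d} {R : realType}.
Variable P : probability Omega R.
Context {dU : measure_display} {SU : measurableType dU} (U : {RV P >-> SU}).
Variable k : nat.
Local Notation RV := (prod_space (fun _ : 'I_k.+1 => R)).

(** This is what singles out c: the squared determinant of [C] is det S det W / c^k, and c^k = det S
    det W exp(-2 b). *)
Lemma Dstar_cholesky (S W A C : 'M[R]_k.+1) (b : R) :
  posdef S -> posdef W -> A *m A^T = S ->
  A^T *m ((Dstar S W b)^-1 *: W) *m A = C^T *m C ->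
  (forall i j : 'I_k.+1, (j < i)%N -> C i j = 0) -> (forall i, 0 < C i i) ->
  ln (\prod_i C i i) = b.
Proof.
move=> S0 W0 AA VE Ctri Cpos; have dS := posdef_det_gt0 S0; have dW := posdef_det_gt0 W0.
have prod0 : 0 < \prod_i C i i by exact: prodr_gt0.
have : (\prod_i C i i) ^+ 2 = expR (2 * b).
  rewrite -det_cholesky// -VE !det_mulmx detZ exprVn DstarX//.
  have -> : \det A^T * ((\det S * \det W * expR (- (2 * b)))^-1 * \det W) * \det A =
    (\det A * \det A^T) * \det W / (\det S * \det W * expR (- (2 * b))) by ring.
  rewrite -det_mulmx AA expRN invfM invrK mulrA divff ?mul1r//.
  by rewrite mulf_neq0// gt_eqF.
move/(congr1 (@ln R)); rewrite lnXn// expRK -mulr_natl; lra.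
Qed.

(** In whitened coordinates the log-likelihood ratio is the sum of z_i^2 / 2 - (C z + bb)_i^2 / 2,
    plus ln det C, where C z + bb = H (x - g). The triangular form gives its exponential integral,
    the form in x - g its mean. *)
Lemma gaussian_rate_bound (S W : 'M[R]_k.+1) (X : 'I_k.+1 -> {RV P >-> R}) (b : R) :
  posdef S -> posdef W -> gaussian_vector X S ->
  info_le (joint X : {RV P >-> _}) U b ->
  k.+1%:R * Dstar S W b <= \tr (W *m condcov X U).
Proof.
move=> S0 W0 [A [Z [AA hZ XE]]] info.
have uA : A \in unitmx.
  by have := posdef_unitmx S0; rewrite -AA !unitmxE det_mulmx unitrM => /andP[].
pose c := Dstar S W b; have c0 : 0 < c := Dstar_gt0 b S0 W0.
have V0 : posdef (A^T *m (c^-1 *: W) *m A).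
  by apply: posdef_congr => //; apply: posdef_scale => //; rewrite invr_gt0.
have [C [VE Ctri Cpos]] := posdef_cholesky V0.
have lnC := Dstar_cholesky S0 W0 AA VE Ctri Cpos.
have prodC0 : 0 < \prod_i C i i by exact: prodr_gt0.
(* [H] is a square root of W / c in the coordinates of X: |H (x - g)|^2 = (x - g)^T W (x - g) /
   c. *)
pose H := C *m invmx A.
have HH : H^T *m H = c^-1 *: W.
  rewrite trmx_mul -!mulmxA (mulmxA C^T) -VE trmx_inv !mulmxA mulVmx ?unitmx_tr//.
  by rewrite mul1mx mulmxK.
pose g (u : SU) i := condexp U (X i) u.
pose zc (x : RV) i := \sum_j invmx A i j * x j.
pose bb u i := - \sum_j H i j * g u j.
pose D i w := X i w - g (U w) i.
have zcX w i : zc (joint X w) i = Z i w.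
  pose Zv : 'cV[R]_k.+1 := \col_i Z i w.
  have := congr1 (fun M : 'cV[R]_k.+1 => M i 0) (mulKmx uA Zv).
  rewrite !mxE => <-; apply: eq_bigr => j _; congr (_ * _).
  by rewrite /joint XE mxE; apply: eq_bigr => l _; rewrite mxE.
have CZ w i : \sum_j C i j * Z j w + bb (U w) i = \sum_j H i j * D j w.
  pose Zv : 'cV[R]_k.+1 := \col_i Z i w.
  have -> : \sum_j C i j * Z j w = \sum_j H i j * X j w.
    have E : C *m Zv = H *m (A *m Zv) by rewrite /H -!mulmxA mulKmx.
    move/(congr1 (fun M : 'cV[R]_k.+1 => M i 0)): E; rewrite [LHS]mxE [RHS]mxE => E.
    transitivity (\sum_j C i j * Zv j 0); first by apply: eq_bigr => j _; rewrite mxE.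
    rewrite E; apply: eq_bigr => j _; congr (_ * _).
    by rewrite XE mxE; apply: eq_bigr => l _; rewrite mxE.
  rewrite /bb /D -sumrB; apply: eq_bigr => j _; by rewrite mulrBr.
have mzc i : measurable_fun setT (fun v : RV * SU => zc v.1 i).
  apply: (measurableT_comp (f := fun x => zc x i)); last exact: measurable_fst.
  apply: measurable_sum => j; apply: measurable_funM => //.
  exact: (@measurable_coord _ _ (fun _ : 'I_k.+1 => R) j).
have mbb i : measurable_fun setT (fun v : RV * SU => bb v.2 i).
  apply: (measurableT_comp (f := fun u => bb u i)); last exact: measurable_snd.
  apply: measurableT_comp => //; apply: measurable_sum => j.
  by apply: measurable_funM => //; exact: measurable_condexp.
clearbody zc bb.
pose f (v : RV * SU) := \sum_i (zc v.1 i ^+ 2 / 2 -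
  (\sum_j C i j * zc v.1 j + bb v.2 i) ^+ 2 / 2) + ln (\prod_i C i i).
have mf : measurable_fun setT f.
  apply: measurable_funD => //; apply: measurable_sum => i; apply: measurable_funB.
    by apply: measurable_funM => //; exact: measurable_funX.
  apply: measurable_funM => //; apply: measurable_funX; apply: measurable_funD => //.
  by apply: measurable_sum => j; exact: measurable_funM.
have f1 : (\int[indep_law (joint X : {RV P >-> _}) U]_z (expR (f z))%:E <= 1)%E.
  have mef : measurable_fun setT (fun z => (expR (f z))%:E).
    by apply/measurable_EFinP; exact: measurableT_comp.
  rewrite integral_indep_law//.
  rewrite (eq_integral (cst 1%E)); first by rewrite integral_cst//= probability_setT mule1.
  (* With u = U w frozen, [bb] is a constant shift and the integral over x becomes one over [Z],
     whose value cancels the factor det C. *)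
  move=> w _.
  have meU : measurable_fun setT (fun x : RV => (expR (f (x, U w)))%:E).
    exact: (measurableT_comp mef (measurable_pair2 _)).
  rewrite ge0_integral_distribution//.
  transitivity (\int[P]_w' ((\prod_i C i i)%:E * (\prod_i expR (joint Z w' i ^+ 2 / 2 -
      (\sum_j C i j * joint Z w' j + bb (U w) i) ^+ 2 / 2))%:E))%E.
    apply: eq_integral => w' _; rewrite /= /f expRD lnK ?posrE// mulrC EFinM.
    congr (_ * _%:E)%E; rewrite expR_sum; apply: eq_bigr => i _ /=.
    rewrite zcX; have -> : \sum_j C i j * zc (joint X w') j = \sum_j C i j * joint Z w' j.
      by apply: eq_bigr => j _; rewrite zcX.
    by [].
  rewrite ge0_integralZl//.
  - by rewrite gauss_triangular// -EFinM prodfV divff// gt_eqF.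
  - apply/measurable_EFinP; apply: measurable_prod => i _.
    apply: measurableT_comp => //; apply: measurable_funB.
      by apply: measurable_funM => //; apply: measurable_funX; exact: measurable_funPT.
    apply: measurable_funM => //; apply: measurable_funX; apply: measurable_funD => //.
    apply: measurable_sum => j; apply: measurable_funM => //; exact: measurable_funPT.
  - by move=> w' _; rewrite lee_fin prodr_ge0// => i _; exact: expR_ge0.
  - by rewrite lee_fin ltW.
have Z2 i := (iid_normal_sqr hZ i).1.
have Z1 i := (iid_normal_sqr hZ i).2.
have D2 i : sqr_integrable P (D i).
  have X2 : sqr_integrable P (X i).
    rewrite (_ : X i = (fun w => \sum_j A i j * Z j w) :> (Omega -> R)); last first.
      by apply/funext => w; exact: XE.
    by apply: sqr_integrable_sum => j; apply: sqr_integrableZ; split.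
  have g2 : sqr_integrable P (fun w => -1 * g (U w) i).
    apply: sqr_integrableZ; split; last exact: condexp_sqr_integrable X2.1 X2.2.
    exact: (measurableT_comp (measurable_condexp U (X i))).
  rewrite (_ : D i = fun w => X i w + -1 * g (U w) i); first exact: sqr_integrableD.
  by apply/funext => w; rewrite mulN1r.
have DD i j : has_mean P (fun w => D i w * D j w) (condcov X U i j).
  have := integrable_has_mean (sqr_integrableM (D2 i) (D2 j)).
  by rewrite mxE unlock.
have fE w : f (joint X w, U w) = \sum_i 2^-1 * Z i w ^+ 2 +
    (- (2 * c)^-1) * (\sum_i \sum_j W i j * (D j w * D i w)) + ln (\prod_i C i i).
  rewrite /f /=; congr (_ + _).
  pose Dv : 'cV[R]_k.+1 := \col_i D i w.
  have q1 : ((H *m Dv)^T *m (H *m Dv)) 0 0 = \sum_i (\sum_j H i j * D j w) ^+ 2.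
    rewrite mxE; apply: eq_bigr => i _; rewrite [X in X * _]mxE -expr2.
    by congr (_ ^+ 2); rewrite mxE; apply: eq_bigr => j _; rewrite [Dv _ _]mxE.
  have q2 : ((H *m Dv)^T *m (H *m Dv)) 0 0 =
      c^-1 * \sum_i \sum_j W i j * (D j w * D i w).
    rewrite trmx_mul mulmxA -(mulmxA Dv^T) HH quad_sum mulr_sumr.
    apply: eq_bigr => i _; rewrite mulr_sumr; apply: eq_bigr => j _.
    by rewrite !mxE; ring.
  rewrite sumrB; congr (_ + _); first by apply: eq_bigr => i _; rewrite zcX mulrC.
  rewrite -mulr_suml invfM mulNr -mulrA -q2 q1 mulrC; congr (- (_ * _)).
  apply: eq_bigr => i _; rewrite -CZ; congr ((_ + _) ^+ 2).
  by apply: eq_bigr => j _; rewrite zcX.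
have fm := has_meanD (has_meanD
  (has_mean_sum (fun i => has_meanZ 2^-1 (integrable_has_mean (Z2 i))))
  (has_meanZ (- (2 * c)^-1)
     (has_mean_sum (fun i => has_mean_sum (fun j => has_meanZ (W i j) (DD j i))))))
  (has_mean_cst P (ln (\prod_i C i i))).
have {fm} := fm; rewrite -(funext fE) => /(info_le_test mf info f1).
rewrite lnC.
have -> : \sum_i \sum_j W i j * condcov X U j i = \tr (W *m condcov X U).
  by apply: eq_bigr => i _; rewrite mxE.
set s := \sum_i _; set t := \tr _ => le_b.
(* Since ln det C = b, the budget cancels from [le_b], leaving s <= t / (2 c); here [s] is half the
   sum of the E Z_i^2. *)
have s_ge : k.+1%:R / 2 <= s.
  rewrite (_ : k.+1%:R / 2 = \sum_(i < k.+1) 2^-1); last first.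
    by rewrite sumr_const card_ord -[RHS]mulr_natl.
  apply: ler_sum => i _; rewrite ler_peMr// -lee_fin fineK//.
  exact: integrable_fin_num (Z2 i).
have : s <= (2 * c)^-1 * t by move: le_b; rewrite mulNr; lra.
rewrite invfM -mulrA => st.
have : k.+1%:R <= c^-1 * t by lra.
by rewrite ler_pdivlMl// mulrC.
Qed.

End gaussian_rate.

Lemma DstarE (R : realType) (k : nat) (S W : 'M[R]_k) (n : nat) (r : R) :
  k%:R * Dstar S W (n%:R * r) =
  k%:R * (\det S * \det W) `^ (k%:R^-1) * expR (- 2 * n%:R * (r / k%:R)).
Proof. by rewrite /Dstar mulrA; congr (_ * expR _); ring. Qed.

(** Removes the slack [e] of each step, in total t e: by exp(-y) >= 1 - y the bound loses at most 2
    t D e. *)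
Lemma Dstar_right_continuous (R : realType) (k : nat) (S W : 'M[R]_k.+1) (b t x : R) :
  posdef S -> posdef W -> 0 <= t ->
  (forall e, 0 < e -> k.+1%:R * Dstar S W (b + t * e) <= x) ->
  k.+1%:R * Dstar S W b <= x.
Proof.
move=> S0 W0 t0 le_x; have D0 := Dstar_gt0 b S0 W0.
apply/ler_addgt0Pr => e e0; set D := Dstar S W b in D0 *.
have tD0 : 0 <= 2 * t * D by apply: mulr_ge0; [exact: mulr_ge0|exact: ltW].
have tD : 0 < 2 * t * D + 1 by lra.
(* The summand 1 keeps the divisor positive when t = 0, the case of an empty procedure. *)
pose e' := e / (2 * t * D + 1).
have e'0 : 0 < e' by exact: divr_gt0.
have := le_x _ e'0.
have -> : Dstar S W (b + t * e') = D * expR (- (2 * (t * e') / k.+1%:R)).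
  rewrite /D /Dstar -[RHS]mulrA -expRD; congr (_ * expR _); ring.
have : D * (1 - 2 * (t * e') / k.+1%:R) <= D * expR (- (2 * (t * e') / k.+1%:R)).
  by rewrite ler_pM2l//; exact: expR_ge1Dx.
rewrite -(ler_pM2l (ltr0Sn R k)) => h1 h2; have {h1 h2} := le_trans h1 h2.
have -> : k.+1%:R * (D * (1 - 2 * (t * e') / k.+1%:R)) =
    k.+1%:R * D - 2 * t * D * e' :> R by field.
have : 2 * t * D * e' <= e.
  by rewrite /e' mulrA ler_pdivrMr// [_ * e]mulrC ler_pM2l// lerDl.
lra.
Qed.

Theorem corollary4 (R : realType) (k : nat) (hk : (1 <= k)%N)
  (d : measure_display) (Omega : measurableType d) (P : probability Omega R)
  (SigmaX : 'M[R]_k) (hSigmaX : posdef SigmaX)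
  (X : 'I_k -> {RV P >-> R}) (hX : gaussian_vector X SigmaX)
  (B We : 'M[R]_k) (hWe : posdef We) :
  let W := tildeW We B in
  (forall (L : nat) (Rl : 'I_L -> R) (R0 : R),
     (forall l, Rl l = R0) ->
     let Rtot := \sum_(l < L) Rl l in
     interior_regime SigmaX W Rtot ->
     Rtot = L%:R * R0 /\
     Dopt SigmaX W (L%:R * R0) =
       k%:R * (\det SigmaX * \det W) `^ (k%:R^-1)
         * expR (- 2 * L%:R * (R0 / k%:R))) /\
  (forall (T : nat) (Rstep : R) (dM : measure_display)
     (S : nat -> measurableType dM) (M : forall t, {RV P >-> S t}),
     (forall t, (t < T)%N ->
        (cond_mutual_info (joint X) (M t) (joint (fun s : 'I_t => M s))
           <= Rstep%:E)%E) ->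
     let Rtot := T%:R * Rstep in
     interior_regime SigmaX W Rtot ->
     Dopt SigmaX W Rtot <=
       \tr (W *m condcov X (joint (fun s : 'I_T => M s))) /\
     Dopt SigmaX W Rtot =
       k%:R * (\det SigmaX * \det W) `^ (k%:R^-1)
         * expR (- 2 * T%:R * (Rstep / k%:R))).
Proof.
case: k hk SigmaX hSigmaX X hX B We hWe => [//|k] _ S S0 X hX B We _ W.
split.
- move=> L Rl R0 RlE Rtot interior.
  have RtotE : Rtot = L%:R * R0.
    by rewrite /Rtot (eq_bigr (fun=> R0))// sumr_const card_ord -[LHS]mulr_natl.
  by split => //; rewrite -RtotE Dopt_interior// RtotE DstarE.
- move=> T Rstep dM S' M budget Rtot interior.
  rewrite Dopt_interior//; split; last exact: DstarE.
  have W0 : posdef W by case: interior.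
  (* With slack [e] in each of the [T] steps the budget is T (Rstep + e), that is Rtot + T e. *)
  apply: (@Dstar_right_continuous _ _ _ _ _ T%:R) => // e e0.
  rewrite -mulrDr; apply: gaussian_rate_bound => //.
  exact: info_le_chain.
Qed.
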